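(* Let $H$ be an infinite-dimensional complex Hilbert space and let $f:\mathcal{G}_{\infty}(H)\to\mathcal{G}_{\infty}(H)$ be a bijection preserving the compatibility relation in both directions, i.e. for all $X,Y\in\mathcal{G}_{\infty}(H)$, $X$ and $Y$ are compatible if and only if $f(X)$ and $f(Y)$ are compatible. Then there exists an automorphism $g$ of the logic $\mathcal{L}(H)$ such that for every $X\in\mathcal{G}_{\infty}(H)$ we have either $f(X)=g(X)$ or $f(X)=g(X)^{\perp}$.
   Context: $\mathcal{L}(H)$ is the lattice of all closed subspaces of $H$ (ordered by inclusion; meet is intersection, join is the closure of the sum) together with the orthogonal complementation $X\mapsto X^{\perp}$. $\mathcal{G}_{\infty}(H)$ is the set of all closed subspaces of $H$ whose dimension and codimension are both infinite. An automorphism of the logic $\mathcal{L}(H)$ is a bijection $g:\mathcal{L}(H)\to\mathcal{L}(H)$ with $X\subset Y\Leftrightarrow g(X)\subset g(Y)$ for all $X,Y$ and $g(X^{\perp})=g(X)^{\perp}$ for all $X$. Two closed subspaces $X,Y$ of $H$ are compatible if there are closed subspaces $X',Y'$ such that $X\cap Y$, $X'$, $Y'$ are mutually orthogonal and $X=(X\cap Y)+X'$, $Y=(X\cap Y)+Y'$. *)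

(* Defs.v *)
From HB Require Import structures.
From mathcomp Require Import all_boot all_order all_algebra.
From mathcomp Require Import sesquilinear complex.
From mathcomp Require Import all_classical all_reals all_analysis.

Set Implicit Arguments.
Unset Strict Implicit.
Unset Printing Implicit Defensive.

Import Order.TTheory GRing.Theory Num.Theory.
Import numFieldNormedType.Exports.

Local Open Scope classical_set_scope.
Local Open Scope ring_scope.
Local Open Scope complex_scope.

Section Dimension.
Context {K : fieldType} {V : lmodType K}.
Implicit Types (s : seq V) (X : set V).

Definition lspan s : set V :=
  [set v | exists a : 'I_(size s) -> K, v = \sum_(i < size s) a i *: s`_i].

Definition finite_dim X : Prop := exists s, X = lspan s.

(* The quotient V / X is generated by the classes of finitely many vectors. *)
Definition finite_codim X : Prop :=
  exists s, forall v : V, exists2 x, X x & lspan s (v - x).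

End Dimension.

(* A complex Hilbert space is a complete normed module H over R[i] with a
   positive definite Hermitian form dot inducing the norm of H; this last
   condition (`|x| ^+ 2 = dot x x) is a hypothesis of the theorem. Following
   {dot _ for _}, the form is linear in its first argument. *)
Section HilbertLogic.
Context {R : realType} {H : completeNormedModType R[i]}.
Variable dot : {dot H for @Num.conj R[i]}.
Implicit Types (X Y : set H) (g : set H -> set H).

Definition orthogonal_sets X Y : Prop :=
  forall x y, X x -> Y y -> dot x y = 0.

Definition orthocomplement X : set H :=
  [set y | forall x, X x -> dot y x = 0].

Definition sum_sets X Y : set H := [set x + y | x in X & y in Y].

(* The set of closed subspaces of H, i.e. the logic L(H). *)
Definition closed_subspaces : set (set H) :=
  [set X : set H | submod_closed [in X] /\ closed X].

Definition Ginfty : set (set H) :=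
  [set X : set H | [/\ closed_subspaces X, ~ finite_dim X & ~ finite_codim X]].

Definition compatible X Y : Prop :=
  exists X' Y', [/\ closed_subspaces X' /\ closed_subspaces Y',
    [/\ orthogonal_sets (X `&` Y) X', orthogonal_sets (X `&` Y) Y'
      & orthogonal_sets X' Y'],
    X = sum_sets (X `&` Y) X'
    & Y = sum_sets (X `&` Y) Y'].

(* Maps between sets of subspaces are total maps on set H; only their
   restrictions to closed_subspaces, resp. Ginfty, are meaningful. *)
Definition logic_automorphism g : Prop :=
  [/\ set_bij closed_subspaces closed_subspaces g,
      forall X Y, closed_subspaces X -> closed_subspaces Y ->
        (X `<=` Y <-> g X `<=` g Y)
    & forall X, closed_subspaces X ->
        g (orthocomplement X) = orthocomplement (g X)].

End HilbertLogic.

(* Main.v *)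
Require Import Defs.
From mathcomp Require Import all_boot all_order all_algebra.
From mathcomp Require Import sesquilinear complex ring lra.
From mathcomp Require Import all_classical all_reals all_analysis.

Set Implicit Arguments.
Unset Strict Implicit.
Unset Printing Implicit Defensive.

Import Order.TTheory GRing.Theory Num.Theory.
Import numFieldNormedType.Exports.

Local Open Scope classical_set_scope.
Local Open Scope ring_scope.
Local Open Scope complex_scope.

(** Commutation of two closed subspaces says that the orthogonal projections
    onto them commute, so it cannot tell a subspace X from its orthocomplement.
    The proof recovers from it the lines of the Hilbert space, together with
    the relation that a line lies in X or in X⊥, and then rebuilds all closed
    subspaces from their lines.  Call X biinfinite when it has infinite
    dimension and codimension, and let f be the given bijection.

    1. Definability.  Every biinfinite S that commutes with all biinfinite
    subspaces commuting with X and Y contains or is orthogonal to every vector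
    v that lies in X or X⊥ and in Y or Y⊥, because X ∩ v⊥ is such a subspace
    ([bicommutant_side]).  So S is the sum of some of the four pieces X ∩ Y,
    X ∩ Y⊥, X⊥ ∩ Y, X⊥ ∩ Y⊥.  Counting these S up to complement shows whether one of
    the pieces vanishes: [nestedP] expresses by commutation only that X and Y are
    comparable up to complements.  Now X and Y = X ∩ v⊥, which differ by
    the line of v, are nested and nothing lies between them.  A subspace T
    between X and Y would come with the subspace W that splits the interval the
    other way, and T and W cross, that is, commute without being nested; this
    is again expressible ([adjacent], [hyperplane_adjacent],
    [adjacent_differ_by]).  Hence f maps pairs that differ by a line to pairs
    that differ by a line.

    2. Parallel transport.  One line is the difference of many pairs, and their
    images must all differ by the same line.  For v in Z, Z included in X, the
    pairs (X, X ∩ v⊥) and (Z, Z ∩ v⊥) form a square in which the two diagonals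
    behave differently (one is nested, the other crosses), and this is enough
    to force a common line on the images ([parallel_hyperplane],
    [corr_parallel]).  If X and Z both contain v, choose orthogonal
    infinite-dimensional P in X ∩ v⊥ and Q in Z ∩ v⊥.  Then X shrinks to P + v,
    whose pair (P + v, P) is up to complement (P⊥, P⊥ ∩ v⊥), and P⊥ shrinks to
    Q + v, which commutes with Z.  So the line attached to the image of
    (X, X ∩ v⊥) lies in f(Z) or in f(Z)⊥ ([differ_by_transport]).

    3. Reconstruction.  This gives a correspondence of lines, bijective by
    [line_corr_total] and [line_corr_unique], which preserves orthogonality
    ([line_corr_dot]).  A closed subspace is the set of vectors orthogonal to
    its orthocomplement, so the correspondence induces an automorphism g of the
    lattice of closed subspaces.  Non-orthogonality connects all the lines of X
    to each other, hence g(X) lies on one side of f(X), and g(X) is f(X) or its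
    orthocomplement ([image_subspace_eq_perp]).

    All of this uses only a reflexive anisotropic form for which every
    orthocomplement splits the space, and is done in that generality.  The
    analytic input is the projection theorem ([projection_theorem]), which
    shows that a Hilbert space is such a space and that topologically closed
    subspaces are those equal to their double orthocomplement. *)

(** * Orthocomplements and commuting subspaces *)

Section Orthomodular.
Variables (K : fieldType) (V : lmodType K) (dot : V -> V -> K).
Implicit Types (X Y Z S A T W : set V) (u v w x : V) (s t : seq V).

Definition perp A : set V := [set y | forall x, A x -> dot y x = 0].

Definition vperp v : set V := [set y | dot y v = 0].

Definition ortho_closed X := perp (perp X) = X.

(** The algebraic content of a Hilbert space.  Orthogonality is symmetric but
    [dot] need not be: in its second argument, [dotDr] and [dotZr] below only
    propagate zeros. *)
Record orthomodular_form : Prop := OrthomodularForm {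
  form_linear : forall a u v w, dot (a *: u + v) w = a * dot u w + dot v w;
  form_reflexive : forall u v, dot u v = 0 -> dot v u = 0;
  form_anisotropic : forall u, dot u u = 0 -> u = 0;
  form_splits : forall A v, exists2 a, perp A a & perp (perp A) (v - a) }.

Hypothesis dotP : orthomodular_form.

(** Infinite dimension, in the form in which it is used: finitely many linear
    conditions never exhaust X.  [not_large_finite] and [large_infinite] compare
    it with [finite_dim]. *)
Definition large X :=
  forall s, exists x, [/\ X x, x != 0 & forall y, y \in s -> dot x y = 0].

Definition biinfinite X := [/\ ortho_closed X, large X & large (perp X)].

(** The orthogonal projections onto X and Y commute; this is compatibility.
    The definition only asks that the projection onto Y maps X into X. *)
Definition commutes X Y :=
  forall x, X x -> exists2 a, X a /\ Y a & perp Y (x - a).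

(** The line of v commutes with X. *)
Definition side v X := X v \/ perp X v.

Definition eq_perp X Y := X = Y \/ X = perp Y.

(** Membership of S in the bicommutant of X and Y, computed within biinfinite
    subspaces because the given bijection acts on them only. *)
Definition bicommutant X Y S := forall Z, biinfinite Z -> commutes Z X ->
  commutes Z Y -> commutes Z S.

(** One of the four pieces cut out by X and Y vanishes.  This is the trace that
    inclusion leaves when subspaces are known up to orthocomplement. *)
Definition nested X Y :=
  [\/ X `<=` Y, X `<=` perp Y, perp X `<=` Y | perp X `<=` perp Y].

Definition crossing X Y := commutes X Y /\ ~ nested X Y.

Lemma subB_subl u v w : (w - v) - (w - u) = u - v.
Proof. by rewrite opprB [LHS]addrC addrA subrK. Qed.

Lemma dotDl u v w : dot (u + v) w = dot u w + dot v w.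
Proof. by have := form_linear dotP 1 u v w; rewrite scale1r mul1r. Qed.

Lemma dot0l w : dot 0 w = 0.
Proof. by apply: (addIr (dot 0 w)); rewrite -dotDl !add0r. Qed.

Lemma dotZl a u w : dot (a *: u) w = a * dot u w.
Proof. by have := form_linear dotP a u 0 w; rewrite dot0l !addr0. Qed.

Lemma dotNl u w : dot (- u) w = - dot u w.
Proof. by rewrite -scaleN1r dotZl mulN1r. Qed.

Lemma dotBl u v w : dot (u - v) w = dot u w - dot v w.
Proof. by rewrite dotDl dotNl. Qed.

Lemma dotC u v : dot u v = 0 -> dot v u = 0.
Proof. exact: form_reflexive. Qed.

Lemma dot0r u : dot u 0 = 0.
Proof. exact/dotC/dot0l. Qed.

Lemma dotDr u v w : dot w u = 0 -> dot w v = 0 -> dot w (u + v) = 0.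
Proof. by move=> /dotC uw /dotC vw; apply: dotC; rewrite dotDl uw vw addr0. Qed.

Lemma dotZr a u w : dot w u = 0 -> dot w (a *: u) = 0.
Proof. by move=> /dotC uw; apply: dotC; rewrite dotZl uw mulr0. Qed.

Lemma dotNr u w : dot w u = 0 -> dot w (- u) = 0.
Proof. by move=> wu; rewrite -scaleN1r dotZr. Qed.

Lemma dotBr u v w : dot w u = 0 -> dot w v = 0 -> dot w (u - v) = 0.
Proof. by move=> wu wv; rewrite dotDr // dotNr. Qed.

Lemma dot_neq0 u : u != 0 -> dot u u != 0.
Proof. by apply: contraNneq => /(form_anisotropic dotP) ->. Qed.

Lemma perp0 A : perp A 0.
Proof. by move=> x _; rewrite dot0l. Qed.

Lemma perpZ A a u : perp A u -> perp A (a *: u).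
Proof. by move=> Au x Ax; rewrite dotZl Au ?mulr0. Qed.

Lemma perpD A u v : perp A u -> perp A v -> perp A (u + v).
Proof. by move=> Au Av x Ax; rewrite dotDl Au ?Av ?addr0. Qed.

Lemma perpB A u v : perp A u -> perp A v -> perp A (u - v).
Proof. by move=> Au Av x Ax; rewrite dotBl Au ?Av ?subr0. Qed.

Lemma perpS A X : A `<=` X -> perp X `<=` perp A.
Proof. by move=> AX u Xu x /AX; exact: Xu. Qed.

Lemma sub_perpK A : A `<=` perp (perp A).
Proof. by move=> a Aa x; move/(_ a Aa)/dotC. Qed.

Lemma perp_cl A : ortho_closed (perp A).
Proof.
by apply/seteqP; split; [exact/perpS/sub_perpK|exact: sub_perpK].
Qed.

Lemma perpU A X : perp (A `|` X) = perp A `&` perp X.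
Proof.
apply/seteqP; split=> [u AXu|u [Au Xu] x [/Au//|/Xu//]].
by split=> x ?; apply: AXu; [left|right].
Qed.

Lemma clI X Y : ortho_closed X -> ortho_closed Y -> ortho_closed (X `&` Y).
Proof. by move=> <- <-; rewrite -perpU; exact: perp_cl. Qed.

Lemma vperpE v : vperp v = perp [set v].
Proof. by apply/seteqP; split=> [u uv _ ->//|u /(_ v)]; exact. Qed.

Lemma vperp_cl v : ortho_closed (vperp v).
Proof. by rewrite vperpE; exact: perp_cl. Qed.

Lemma cl_setT : ortho_closed setT.
Proof. by apply/seteqP; split=> // x _ y yT; apply: dotC; apply: yT. Qed.

Lemma cl0 X : ortho_closed X -> X 0.
Proof. by move=> <-; exact: perp0. Qed.

Lemma clZ X a u : ortho_closed X -> X u -> X (a *: u).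
Proof. by move=> <-; exact: perpZ. Qed.

Lemma clD X u v : ortho_closed X -> X u -> X v -> X (u + v).
Proof. by move=> <-; exact: perpD. Qed.

Lemma clB X u v : ortho_closed X -> X u -> X v -> X (u - v).
Proof. by move=> <-; exact: perpB. Qed.

Lemma perp_disj X u : X u -> perp X u -> u = 0.
Proof. by move=> Xu /(_ u Xu); exact: form_anisotropic. Qed.

Lemma cl_split X v : ortho_closed X -> exists2 a, X a & perp X (v - a).
Proof.
move=> Xcl; have [a] := form_splits dotP (perp X) v.
by rewrite Xcl => Xa va; exists a.
Qed.

Lemma cl_sub X Y : ortho_closed Y -> perp Y `<=` perp X -> X `<=` Y.
Proof.
move=> Ycl /perpS; rewrite Ycl; apply: subset_trans; exact: sub_perpK.
Qed.

(** The relative orthocomplement of X ∩ v⊥ in X is the line of v. *)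
Lemma line_in X v u : ortho_closed X -> X v -> v != 0 -> X u ->
  perp (X `&` vperp v) u -> exists c, u = c *: v.
Proof.
move=> Xcl Xv v0 Xu uperp; exists (dot u v / dot v v).
set c := _ / _; pose w := u - c *: v.
suff w0 : w = 0 by rewrite -[u](subrK (c *: v)) -/w w0 add0r.
have Xw : X w by apply: clB => //; exact: clZ.
have wv : dot w v = 0.
  by rewrite /w dotBl dotZl divfK ?subrr // dot_neq0.
have wu : dot u w = 0 by apply: uperp.
apply: (form_anisotropic dotP); rewrite {1}/w dotBl wu dotZl (dotC wv).
by rewrite mulr0 subr0.
Qed.

Lemma commutes_sym X Y : ortho_closed X -> ortho_closed Y -> commutes X Y ->
  commutes Y X.
Proof.
move=> Xcl Ycl XY y Yy; have [a Xa Xya] := cl_split y Xcl.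
have [b [Xb Yb] Yab] := XY a Xa.
suff ab : a = b by exists a => //; split=> //; rewrite ab.
apply/eqP; rewrite -subr_eq0; apply/eqP; apply: (form_anisotropic dotP).
have -> : dot (a - b) (a - b) = dot (y - b) (a - b) - dot (y - a) (a - b).
  by rewrite -dotBl subB_subl.
rewrite (Xya (a - b)) ?subr0; last exact: clB.
by apply: dotC; apply: Yab; apply: clB.
Qed.

Lemma commutes_perpr X Y : ortho_closed X -> ortho_closed Y -> commutes X Y ->
  commutes X (perp Y).
Proof.
move=> Xcl Ycl XY x Xx; have [a [Xa Ya] Yxa] := XY x Xx.
exists (x - a); first by split=> //; exact: clB.
by rewrite opprB addrC subrK; exact: sub_perpK.
Qed.

Lemma commutes_perpl X Y : ortho_closed X -> ortho_closed Y -> commutes X Y ->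
  commutes (perp X) Y.
Proof.
move=> Xcl Ycl XY; apply: commutes_sym => //; first exact: perp_cl.
by apply: commutes_perpr => //; exact: commutes_sym.
Qed.

Lemma commutes_sub X Y : X `<=` Y -> commutes X Y.
Proof.
by move=> XY x Xx; exists x; [split=> //; exact: XY|rewrite subrr; exact: perp0].
Qed.

Lemma commutes_refl X : commutes X X.
Proof. exact: commutes_sub. Qed.

(** The two projections onto Z of a vector of X ∩ Y, taken in X and in Y, agree
    by uniqueness of orthogonal decompositions. *)
Lemma commutesIl X Y Z : ortho_closed Z -> commutes X Z -> commutes Y Z ->
  commutes (X `&` Y) Z.
Proof.
move=> Zcl XZ YZ v [/XZ[a [Xa Za] va] /YZ[b [Yb Zb] vb]].
suff ab : a = b by exists a => //; do !split=> //; rewrite ab.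
apply/eqP; rewrite -subr_eq0; apply/eqP.
apply: (@perp_disj Z); first exact: clB.
rewrite -(subB_subl a b v).
exact: perpB.
Qed.

Lemma commutes_vperp v Y : ortho_closed Y -> side v Y -> commutes (vperp v) Y.
Proof.
move=> Ycl sv x xv; have [a Ya Yxa] := cl_split x Ycl; exists a => //.
split=> //; case: sv => [Yv|Yv]; last by apply: dotC; apply: Yv.
by have := Yxa v Yv; rewrite dotBl xv sub0r => /eqP; rewrite oppr_eq0 => /eqP.
Qed.

Lemma side_perp v X : ortho_closed X -> side v (perp X) -> side v X.
Proof. by move=> Xcl [?|]; rewrite ?Xcl; [right|left]. Qed.

(** A subspace commuting with X and with its hyperplane X ∩ v⊥ commutes with
    their difference, the line of v. *)
Lemma side_of_commutes X S v : ortho_closed X -> ortho_closed S -> X v ->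
  v != 0 -> commutes X S -> commutes (X `&` vperp v) S -> side v S.
Proof.
move=> Xcl Scl Xv v0 XS XvS; have [a [Xa Sa] Sva] := XS v Xv.
have [k ak] : exists k, a = k *: v.
  apply: (line_in Xcl) => // u Xu; have [c [[Xc cv] Sc] Suc] := XvS u Xu.
  apply: dotC; rewrite -[u](subrK c) dotDl Suc // add0r.
  rewrite -[a](subKr v); apply: dotBr => //.
  by apply: dotC; apply: Sva.
have [k0|k0] := eqVneq k 0.
  by right; move: Sva; rewrite ak k0 scale0r subr0.
by left; rewrite -(scalerK k0 v) -ak; exact: clZ.
Qed.

(** A vector space is not the union of two proper subspaces. *)
Lemma all_side X S : ortho_closed X -> ortho_closed S ->
  (forall v, X v -> side v S) -> X `<=` S \/ X `<=` perp S.
Proof.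
move=> Xcl Scl XS; have [?|/existsNP[u /not_implyP[Xu Su]]] := pselect (X `<=` S).
  by left.
right=> v Xv; have [//|Spu] := XS u Xu; have [Sv|//] := XS v Xv.
have [Suv|Spuv] := XS _ (clD Xcl Xu Xv).
  by case: Su; rewrite -[u](addrK v); exact: clB.
by rewrite -[v](addKr u) addrC; apply: perpB.
Qed.

(** * Infinite dimension and codimension *)

Lemma largeS X Y : X `<=` Y -> large X -> large Y.
Proof. by move=> XY Xl s; have [x [/XY]] := Xl s; exists x. Qed.

Lemma large_vperp X v : large X -> large (X `&` vperp v).
Proof.
move=> Xl s; have [x [Xx x0 xs]] := Xl (v :: s); exists x; split=> //.
  by split=> //; apply: xs; exact: mem_head.
by move=> y ys; apply: xs; rewrite inE ys orbT.
Qed.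

Lemma large_neq0 X : large X -> exists2 x, X x & x != 0.
Proof. by move=> /(_ [::])[x [Xx x0 _]]; exists x. Qed.

Lemma lspan_perp s u : (forall y, y \in s -> dot u y = 0) ->
  forall x, lspan s x -> dot u x = 0.
Proof.
move=> us _ [c ->]; elim/big_ind: _ => [|x y|i _]; first exact: dot0r.
  exact: dotDr.
by apply: dotZr; apply: us; exact: mem_nth.
Qed.

Lemma large_infinite X : large X -> ~ finite_dim X.
Proof.
move=> Xl [s Xs]; have [x [Xx x0 xs]] := Xl s.
have /(form_anisotropic dotP)/eqP : dot x x = 0.
  by apply: (lspan_perp xs); rewrite -Xs.
by rewrite (negPf x0).
Qed.

Lemma lspan_cons (a : V) s u c : lspan s u -> lspan (a :: s) (c *: a + u).
Proof.
move=> [d ->].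
exists (fun i : 'I_(size s).+1 => if unlift ord0 i is Some j then d j else c).
rewrite big_ord_recl unlift_none; congr (_ + _).
by apply: eq_bigr => i _; rewrite liftK.
Qed.

(** Finitely many linear forms separating the points of X bound its dimension:
    each one is either zero on X or splits off one basis vector. *)
Lemma finite_dim_of_separating X s : submod_closed [in X] ->
  (forall x, X x -> (forall y, y \in s -> dot x y = 0) -> x = 0) ->
  finite_dim X.
Proof.
elim: s X => [|a s IHs] X [X0 Xlin] Xs.
  exists [::]; apply/seteqP; split=> [x Xx|_ [c ->]].
    by exists (fun=> 0); rewrite big_ord0; apply: Xs.
  by rewrite big_ord0; rewrite inE in X0.
have {}Xlin c u v : X u -> X v -> X (c *: u + v).
  by move=> Xu Xv; have := Xlin c u v; rewrite !inE; exact.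
rewrite inE in X0.
have [||t Xt] := IHs (X `&` vperp a).
- split; first by rewrite inE; split=> //; exact: dot0l.
  move=> c u v; rewrite !inE => -[Xu ua] [Xv va].
  split; first exact: Xlin.
  by change (dot (c *: u + v) a = 0); rewrite dotDl dotZl ua va mulr0 addr0.
- move=> x [Xx xa] xs; apply: Xs => // y; rewrite inE => /predU1P[->//|].
  exact: xs.
have [allX|/existsNP[u /not_implyP[Xu ua]]] :=
    pselect (forall x, X x -> vperp a x).
  exists t; rewrite -Xt; apply/seteqP; split=> [x Xx|x []//].
  by split=> //; exact: allX.
have {}ua : dot u a != 0 by apply/eqP.
exists (u :: t); apply/seteqP; split=> [x Xx|_ [c ->]].
  pose c := dot x a / dot u a.
  rewrite -[x](subrK (c *: u)) addrC; apply: lspan_cons; rewrite -Xt; split.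
    by rewrite addrC -scaleNr; exact: Xlin.
  by change (dot (x - c *: u) a = 0); rewrite dotBl dotZl divfK ?subrr.
rewrite big_ord_recl; apply: Xlin => //.
have : lspan t (\sum_(i < size t) c (lift ord0 i) *: t`_i) by eexists.
by rewrite -Xt => -[].
Qed.

Lemma cl_submod X : ortho_closed X -> submod_closed [in X].
Proof.
move=> Xcl; split; first by rewrite inE; exact: cl0.
by move=> c u v; rewrite !inE => Xu Xv; apply: clD => //; exact: clZ.
Qed.

Lemma not_large_finite X : ortho_closed X -> ~ large X -> finite_dim X.
Proof.
move=> Xcl /existsNP[s Xs]; apply: (@finite_dim_of_separating _ s).
  exact: cl_submod.
move=> x Xx xs; have [//|x0] := eqVneq x 0.
by case: Xs; exists x.
Qed.

(** If both pieces of X had finite bases, a vector of X orthogonal to both bases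
    would be orthogonal to itself. *)
Lemma large_comm X Y : ortho_closed X -> ortho_closed Y -> commutes X Y ->
  large X ->
  large (X `&` Y) \/ large (X `&` perp Y).
Proof.
move=> Xcl Ycl XY Xl; apply: contrapT => /not_orP[].
move=> /(not_large_finite (clI Xcl Ycl))[s Es].
move=> /(not_large_finite (clI Xcl (perp_cl Y)))[t Et].
have [x [Xx x0 xst]] := Xl (s ++ t).
have [a [Xa Ya] Yxa] := XY x Xx.
suff /(form_anisotropic dotP)/eqP : dot x x = 0 by rewrite (negPf x0).
rewrite -{2}[x](subrK a); apply: dotDr.
  apply: (@lspan_perp t) => [y yt|]; first by apply: xst; rewrite mem_cat yt orbT.
  by rewrite -Et; split=> //; exact: clB.
apply: (@lspan_perp s) => [y ys|]; first by apply: xst; rewrite mem_cat ys.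
by rewrite -Es.
Qed.

Lemma biinfinite_cl X : biinfinite X -> ortho_closed X. Proof. by case. Qed.

Lemma biinfinite_perp X : biinfinite X -> biinfinite (perp X).
Proof. by move=> [Xcl Xl Xpl]; split=> //; rewrite ?Xcl //; exact: perp_cl. Qed.

Lemma biinfinite_between X Y Z : X `<=` Y -> Y `<=` Z -> large X ->
  large (perp Z) ->
  ortho_closed Y -> biinfinite Y.
Proof.
by move=> XY /perpS YZ Xl Zl Ycl; split=> //; [exact: largeS Xl|exact: largeS Zl].
Qed.

Lemma biinfinite_vperp X v : biinfinite X -> biinfinite (X `&` vperp v).
Proof.
move=> [Xcl Xl Xpl].
apply: (biinfinite_between (@subset_refl _ _) (@subIsetl _ X _)) => //.
  exact: large_vperp.
by apply: clI => //; exact: vperp_cl.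
Qed.

Lemma biinfinite_proper X : biinfinite X -> ~ (forall v, X v).
Proof.
move=> [_ _ /large_neq0[x Xx /eqP x0]] XT; apply: x0.
exact: perp_disj Xx.
Qed.

(** * The bicommutant *)

Lemma commutes_perprE X Y : ortho_closed X -> ortho_closed Y ->
  commutes X (perp Y) <-> commutes X Y.
Proof.
move=> Xcl Ycl; split; last exact: commutes_perpr.
move=> /(commutes_perpr Xcl (perp_cl Y)); by rewrite Ycl.
Qed.

Lemma bicommutant_perpl X Y S : ortho_closed X -> bicommutant X Y S ->
  bicommutant (perp X) Y S.
Proof.
by move=> Xcl XYS Z Zg ZX ZY; apply: XYS => //; apply/commutes_perprE; case: Zg.
Qed.

Lemma bicommutant_sym X Y S : bicommutant X Y S -> bicommutant Y X S.
Proof. by move=> XYS Z Zg ZX ZY; apply: XYS. Qed.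

Lemma bicommutant_perpr X Y S : ortho_closed Y -> bicommutant X Y S ->
  bicommutant X (perp Y) S.
Proof.
by move=> Ycl /bicommutant_sym XYS; apply/bicommutant_sym/bicommutant_perpl.
Qed.

Lemma bicommutant_perp X Y S : ortho_closed S -> bicommutant X Y S ->
  bicommutant X Y (perp S).
Proof.
move=> Scl XYS Z Zg ZX ZY.
by apply: commutes_perpr => //; [case: Zg|exact: XYS].
Qed.

(** The subspace X ∩ v⊥ (or X⊥ ∩ v⊥) is biinfinite and commutes with X and with
    Y, hence with S; so S commutes with the line of v. *)
Lemma bicommutant_side X Y S v : biinfinite X -> biinfinite Y ->
  biinfinite S -> commutes X Y ->
  bicommutant X Y S -> side v X -> side v Y -> side v S.
Proof.
move=> + [Ycl _ _] [Scl _ _] + + vX vY.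
have {}vX : exists2 X', X' v & X' = X \/ X' = perp X.
  by case: vX => ?; eexists; eauto.
case: vX => X' X'v X'E Xg XY XYS.
have Xcl := biinfinite_cl Xg.
have [X'g X'Y X'YS] : [/\ biinfinite X', commutes X' Y & bicommutant X' Y S].
  case: X'E => ->; split=> //; [exact: biinfinite_perp|exact: commutes_perpl|].
  exact: bicommutant_perpl.
have [->|v0] := eqVneq v 0; first by left; exact: cl0.
have X'cl := biinfinite_cl X'g.
apply: (@side_of_commutes X') => //.
  by apply: X'YS => //; exact: commutes_refl.
apply: X'YS; first exact: biinfinite_vperp.
  by apply: commutes_sub => x [].
by apply: commutesIl => //; exact: commutes_vperp.
Qed.

(** Commutation determines a biinfinite subspace up to orthocomplement. *)
Lemma bicommutant_eq_perpP X S : biinfinite X -> biinfinite S ->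
  bicommutant X X S <-> eq_perp S X.
Proof.
move=> Xg Sg; have [Xcl Scl] := (biinfinite_cl Xg, biinfinite_cl Sg).
split; last first.
  by case=> ->; [|apply: bicommutant_perp => //]; move=> Z.
move=> XXS; have XS v : side v X -> side v S.
  by move=> vX; apply: (bicommutant_side Xg Xg) => //; exact: commutes_refl.
have [XsubS|XsubS] := @all_side X S Xcl Scl (fun v Xv => XS v (or_introl Xv));
have [pXS|pXS] :=
  @all_side (perp X) S (perp_cl X) Scl (fun v Xv => XS v (or_intror Xv)).
- case: (biinfinite_proper Sg) => v; have [a Xa Xva] := cl_split v Xcl.
  by rewrite -[v](subrK a); apply: clD => //; [exact: pXS|exact: XsubS].
- left; apply/seteqP; split=> //; exact: cl_sub.
- right; apply/seteqP; split=> //.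
  by apply: (cl_sub (perp_cl X)); rewrite Xcl.
- case: (biinfinite_proper (biinfinite_perp Sg)) => v; have [a Xa Xva] := cl_split v Xcl.
  by rewrite -[v](subrK a); apply: perpD => //; [exact: pXS|exact: XsubS].
Qed.

(** * Inclusion up to orthocomplement, in terms of commutation *)

Lemma eq_perp_sym X Y : ortho_closed Y -> eq_perp X Y -> eq_perp Y X.
Proof. by move=> Ycl [->|->]; [left|right]. Qed.

Lemma eq_perp_trans X Y Z : ortho_closed Z -> eq_perp X Y -> eq_perp Y Z ->
  eq_perp X Z.
Proof. by move=> Zcl [->|->] [->|->]; rewrite ?Zcl; [left|right|right|left]. Qed.

Lemma eq_perp_cl X Y : ortho_closed Y -> eq_perp X Y -> ortho_closed X.
Proof. by move=> Ycl [->|->] //; exact: perp_cl. Qed.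

Lemma eq_perp_biinfinite X Y : biinfinite Y -> eq_perp X Y -> biinfinite X.
Proof. by move=> Yg [->|->] //; exact: biinfinite_perp. Qed.

Lemma commutes_eq_perp X X' Y : ortho_closed X' -> ortho_closed Y ->
  eq_perp X X' -> commutes X' Y -> commutes X Y.
Proof. by move=> X'cl Ycl [->|->] //; exact: commutes_perpl. Qed.

Lemma bicommutant_eq_perp X Y S S' : ortho_closed S' -> eq_perp S S' ->
  bicommutant X Y S' -> bicommutant X Y S.
Proof. by move=> S'cl [->|->] //; exact: bicommutant_perp. Qed.

Lemma sub_perp_sym X Y : X `<=` perp Y -> Y `<=` perp X.
Proof. by move=> /perpS; apply: subset_trans; exact: sub_perpK. Qed.

Lemma perp_sub_sym X Y : ortho_closed X -> perp X `<=` Y -> perp Y `<=` X.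
Proof. by move=> Xcl /perpS; rewrite Xcl. Qed.

Lemma nested_sym X Y : ortho_closed X -> ortho_closed Y -> nested X Y ->
  nested Y X.
Proof.
move=> Xcl Ycl [h|h|h|h].
- by constructor 4; exact: perpS.
- by constructor 2; exact: sub_perp_sym.
- by constructor 3; exact: perp_sub_sym.
- by constructor 1; exact: cl_sub.
Qed.

Lemma nested_perpl X Y : ortho_closed X -> nested X Y -> nested (perp X) Y.
Proof.
move=> Xcl [] h; [constructor 3|constructor 4|constructor 1|constructor 2];
by rewrite ?Xcl.
Qed.

Lemma nested_eq_perp X X' Y Y' : ortho_closed X' -> ortho_closed Y' ->
  eq_perp X X' -> eq_perp Y Y' ->
  nested X' Y' -> nested X Y.
Proof.
move=> X'cl Y'cl XX' YY' XY'; apply: (@nested_sym Y X).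
- exact: eq_perp_cl YY'.
- exact: eq_perp_cl XX'.
have {}XY' : nested Y' X.
  apply: nested_sym => //; first exact: eq_perp_cl XX'.
  by case: XX' => ->//; exact: nested_perpl.
by case: YY' => ->//; exact: nested_perpl.
Qed.

(** If the pieces of X and Y are all nonzero, two opposite ones are infinite
    dimensional, and the bicommutant contains both besides X and Y.  If one
    piece vanishes, X, Y and one further subspace E exhaust it. *)
Definition commutant_nested X Y := commutes X Y /\
  exists2 E, biinfinite E & forall S, biinfinite S -> bicommutant X Y S ->
    [\/ eq_perp S X, eq_perp S Y | eq_perp S E].

Lemma commutant_nested_perpl X Y : ortho_closed X -> ortho_closed Y ->
  commutant_nested X Y -> commutant_nested (perp X) Y.
Proof.
move=> Xcl Ycl [XY [E Eg XYE]]; split; first exact: commutes_perpl.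
exists E => // S Sg /(bicommutant_perpl (perp_cl X)); rewrite Xcl.
move=> /(XYE S Sg)[SX|SY|SE].
- by constructor 1; apply: eq_perp_trans SX _; [exact: perp_cl|right].
- by constructor 2.
- by constructor 3.
Qed.

Lemma commutant_nested_perpr X Y : ortho_closed X -> ortho_closed Y ->
  commutant_nested X Y -> commutant_nested X (perp Y).
Proof.
move=> Xcl Ycl [XY [E Eg XYE]]; split; first exact: commutes_perpr.
exists E => // S Sg /(bicommutant_perpr (perp_cl Y)); rewrite Ycl.
move=> /(XYE S Sg)[SX|SY|SE].
- by constructor 1.
- by constructor 2; apply: eq_perp_trans SY _; [exact: perp_cl|right].
- by constructor 3.
Qed.

(** X, Y ∩ X⊥ and Y⊥ decompose the space, and S contains or is orthogonal to
    each of them. *)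
Lemma chain_bicommutant X Y S : biinfinite X -> biinfinite Y -> biinfinite S ->
  X `<=` Y ->
  bicommutant X Y S -> X `<=` S ->
  [\/ S = X, S = Y | S = perp (Y `&` perp X)].
Proof.
move=> Xg Yg Sg XY XYS XS.
have [Xcl Ycl] := (biinfinite_cl Xg, biinfinite_cl Yg).
have Scl := biinfinite_cl Sg; set E := Y `&` perp X.
have Ecl : ortho_closed E by apply: clI => //; exact: perp_cl.
have XYc : commutes X Y by exact: commutes_sub.
have E_side v : E v -> side v S.
  by case=> Yv Xv; apply: (bicommutant_side Xg Yg) => //; [right|left].
have Y_side v : perp Y v -> side v S.
  by move=> Yv; apply: (bicommutant_side Xg Yg) => //; right => //; exact: (perpS XY).
have split3 v : exists x d b, [/\ X x, E d, perp Y b & v = x + d + b].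
  have [a Ya Yva] := cl_split v Ycl; have [x Xx Xax] := cl_split a Xcl.
  exists x, (a - x), (v - a); split=> //.
    by split=> //; apply: clB => //; exact: XY.
  by rewrite [x + _]addrC subrK addrC subrK.
have [ES|ES] := all_side Ecl Scl E_side;
have [YS|YS] := all_side (perp_cl Y) Scl Y_side.
- case: (biinfinite_proper Sg) => v; have [x [d [b [Xx Ed Yb ->]]]] := split3 v.
  by apply: clD => //; [apply: clD => //; [exact: XS|exact: ES]|exact: YS].
- constructor 2; apply/seteqP; split; first exact: cl_sub.
  move=> y Yy; have [x [d [b [Xx Ed Yb E1]]]] := split3 y.
  have b0 : b = 0.
    apply: (perp_disj _ Yb); rewrite -[b](addKr (x + d)) addrC -E1.
    by apply: clB => //; apply: clD => //; [exact: XY|case: Ed].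
  by rewrite E1 b0 addr0; apply: clD => //; [exact: XS|exact: ES].
- constructor 3; apply/seteqP; split; first exact: sub_perp_sym.
  move=> v Ev; have [x [d [b [Xx Ed Yb E1]]]] := split3 v.
  have d0 : d = 0.
    apply: (perp_disj Ed); have -> : d = v - x - b.
      by rewrite E1 addrAC [x + d]addrC !addrK.
    apply: perpB; [apply: perpB => //|].
      by move=> y [_ Xy]; apply: dotC; apply: Xy.
    by move=> y [Yy _]; exact: Yb.
  by rewrite E1 d0 addr0; apply: clD => //; [exact: XS|exact: YS].
- constructor 1; apply/seteqP; split=> // s Ss.
  have [x [d [b [Xx Ed Yb E1]]]] := split3 s.
  have Ys : Y s by apply: (cl_sub Ycl YS).
  have sx : E (s - x).
    split; first by apply: clB => //; exact: XY.
    rewrite E1 [x + d]addrC addrAC addrK; apply: perpD; first by case: Ed.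
    exact: (perpS XY).
  have /eqP : s - x = 0.
    by apply: (perp_disj _ (ES _ sx)); apply: clB => //; exact: XS.
  by rewrite subr_eq0 => /eqP ->.
Qed.

Lemma sub_commutant_nested X Y : biinfinite X -> biinfinite Y -> X `<=` Y ->
  commutant_nested X Y.
Proof.
move=> Xg Yg XY; split; first exact: commutes_sub.
have Xcl := biinfinite_cl Xg; have Ycl := biinfinite_cl Yg.
set E := Y `&` perp X.
have Ecl : ortho_closed E by apply: clI => //; exact: perp_cl.
pose E' := if pselect (biinfinite E) then E else X.
have EE' : biinfinite E -> E' = E by rewrite /E'; case: pselect.
(* When Y ∩ X⊥ is not biinfinite, no third class occurs and X serves as E. *)
exists E'; first by rewrite /E'; case: pselect.
have main S : biinfinite S -> bicommutant X Y S -> X `<=` S ->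
    [\/ eq_perp S X, eq_perp S Y | eq_perp S E'].
  move=> Sg XYS XS; case: (chain_bicommutant Xg Yg Sg XY XYS XS) => SE.
  - by constructor 1; left.
  - by constructor 2; left.
  - constructor 3; right; rewrite EE' //.
    by rewrite -Ecl -/E -SE; exact: biinfinite_perp.
move=> S Sg XYS; have Scl := biinfinite_cl Sg.
have X_side v : X v -> side v S.
  move=> Xv; apply: (bicommutant_side Xg Yg) => //; [exact: commutes_sub|by left|].
  by left; exact: XY.
have [XS|XS] := all_side Xcl Scl X_side; first exact: main.
have E'cl : ortho_closed E' by rewrite /E'; case: pselect.
have SS : eq_perp S (perp S) by right.
case: (main _ (biinfinite_perp Sg) (bicommutant_perp Scl XYS) XS) => h.
- by constructor 1; apply: eq_perp_trans SS h.
- by constructor 2; apply: eq_perp_trans SS h.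
- by constructor 3; apply: eq_perp_trans SS h.
Qed.

(** Each of X, X⊥, Y, Y⊥ is the sum of two of the four pieces, so no two
    adjacent pieces are both finite dimensional. *)
Lemma large_opposite X Y : biinfinite X -> biinfinite Y -> commutes X Y ->
  large (X `&` Y) /\ large (perp X `&` perp Y) \/
  large (X `&` perp Y) /\ large (perp X `&` Y).
Proof.
move=> [Xcl Xl pXl] [Ycl Yl pYl] XY; have YX := commutes_sym Xcl Ycl XY.
have := large_comm Xcl Ycl XY Xl.
have := large_comm (perp_cl X) Ycl (commutes_perpl Xcl Ycl XY) pXl.
have := large_comm Ycl Xcl YX Yl.
have := large_comm (perp_cl Y) Xcl (commutes_perpl Ycl Xcl YX) pYl.
by rewrite ![_ `&` X]setIC ![_ `&` perp X]setIC; tauto.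
Qed.

(** Otherwise X ∩ Y and X⊥ ∩ Y⊥ would both be in the class of E. *)
Lemma crossing_commutant X Y : biinfinite X -> biinfinite Y ->
  large (X `&` Y) -> large (perp X `&` perp Y) ->
  commutant_nested X Y -> nested X Y.
Proof.
move=> Xg Yg Al Dl [XY [E Eg XYE]]; apply: contrapT => cross.
have [Xcl Ycl] := (biinfinite_cl Xg, biinfinite_cl Yg); have Ecl := biinfinite_cl Eg.
have [N1 N2 N3 N4] : [/\ ~ X `<=` Y, ~ X `<=` perp Y, ~ perp X `<=` Y
    & ~ perp X `<=` perp Y].
  split=> h; apply: cross; [constructor 1|constructor 2|constructor 3|];
  by rewrite //; constructor 4.
set A := X `&` Y; set D := perp X `&` perp Y.
have Acl : ortho_closed A by exact: clI.
have Dcl : ortho_closed D by apply: clI; exact: perp_cl.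
have AD : A `<=` perp D.
  by move=> a [Xa _] d [Xd _]; apply: dotC; exact: Xd.
have Ag : biinfinite A.
  by split=> //; apply: largeS Dl; exact: sub_perp_sym.
have Dg : biinfinite D.
  by split=> //; apply: largeS Al.
have XYA : bicommutant X Y A.
  move=> Z Zg ZX ZY; have Zcl := biinfinite_cl Zg.
  by apply: commutes_sym => //; apply: commutesIl => //; exact: commutes_sym.
have XYD : bicommutant X Y D.
  move=> Z Zg ZX ZY; have Zcl := biinfinite_cl Zg.
  apply: commutes_sym => //; apply: commutesIl => //.
    by apply: commutes_perpl => //; exact: commutes_sym.
  by apply: commutes_perpl => //; exact: commutes_sym.
have AE : eq_perp A E.
  have AX : A `<=` X by move=> ? [].
  have AY : A `<=` Y by move=> ? [].
  case: (XYE A Ag XYA) => // -[] EA; exfalso.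
  - by apply: N1; rewrite -EA.
  - by apply: N3; rewrite -EA.
  - by apply: N4; apply: perpS; rewrite -EA.
  - by apply: N3; apply: perp_sub_sym => //; rewrite -EA.
have DE : eq_perp D E.
  have DX : D `<=` perp X by move=> ? [].
  have DY : D `<=` perp Y by move=> ? [].
  case: (XYE D Dg XYD) => // -[] ED; exfalso.
  - by apply: N2; rewrite -ED.
  - by apply: N4; rewrite -ED.
  - by apply: N2; apply: sub_perp_sym; rewrite -ED.
  - by apply: N1; apply: cl_sub => //; rewrite -ED.
have [EAD|EAD] : eq_perp A D by apply: eq_perp_trans AE (eq_perp_sym Ecl DE).
  have [x Ax /eqP[]] := large_neq0 Al.
  have Dx : D x by rewrite -EAD.
  exact: perp_disj Dx (AD x Ax).
apply: N1; apply: (@subset_trans _ A); last by move=> ? [].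
by rewrite EAD => x Xx d [Xd _]; apply: dotC; exact: Xd.
Qed.

Lemma nestedP X Y : biinfinite X -> biinfinite Y ->
  nested X Y <-> commutant_nested X Y.
Proof.
move=> Xg Yg; have Xcl := biinfinite_cl Xg; have Ycl := biinfinite_cl Yg.
have [pXg pYg] := (biinfinite_perp Xg, biinfinite_perp Yg).
split=> [[]|XY].
- exact: sub_commutant_nested.
- move=> /(sub_commutant_nested Xg pYg) h; rewrite -Ycl.
  by apply: commutant_nested_perpr h => //; exact: perp_cl.
- move=> /(sub_commutant_nested pXg Yg) h; rewrite -Xcl.
  by apply: commutant_nested_perpl h => //; exact: perp_cl.
- move=> /(sub_commutant_nested pXg pYg) h; rewrite -Xcl -Ycl.
  apply: commutant_nested_perpr; rewrite ?Xcl //; try exact: perp_cl.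
  by rewrite -Xcl; apply: commutant_nested_perpl h; exact: perp_cl.
have [[Al Dl]|[Bl Cl]] := large_opposite Xg Yg XY.1.
  exact: crossing_commutant.
suff : nested X (perp Y) by apply: nested_eq_perp => //; [exact: perp_cl|left|right].
apply: crossing_commutant => //; first by rewrite Ycl.
exact: commutant_nested_perpr.
Qed.

(** * Pairs of subspaces that differ by a line *)

(** X and Y are nested with nothing in between.  Being between X and Y is not
    expressible directly for subspaces known up to complement: in a chain of
    three, all pairs are nested and none is the visible middle.  The middle T
    is recognized by the complementary intermediate subspace W, which crosses
    it, X and Y being T ∩ W and T + W. *)
Definition adjacent X Y :=
  [/\ nested X Y, ~ eq_perp X Y & ~ exists T W,
    [/\ biinfinite T /\ biinfinite W, crossing T W,
        bicommutant T W X /\ bicommutant T W Y,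
        nested X T /\ nested X W & nested Y T /\ nested Y W]].

(** Up to complements, Y is the hyperplane of X orthogonal to v. *)
Definition differ_by v X Y := v != 0 /\ exists X' Y',
  [/\ eq_perp X X', eq_perp Y Y', ortho_closed X', X' v & Y' = X' `&` vperp v].

Lemma bicommutant_eq_perpl T T' W S : ortho_closed T' -> eq_perp T T' ->
  bicommutant T' W S -> bicommutant T W S.
Proof. by move=> T'cl [->|->] //; exact: bicommutant_perpl. Qed.

Lemma bicommutant_eq_perpr T W W' S : ortho_closed W' -> eq_perp W W' ->
  bicommutant T W' S -> bicommutant T W S.
Proof. by move=> W'cl [->|->] //; exact: bicommutant_perpr. Qed.

Lemma crossing_eq_perp X X' Y Y' : ortho_closed X' -> ortho_closed Y' ->
  eq_perp X X' -> eq_perp Y Y' ->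
  crossing X' Y' -> crossing X Y.
Proof.
move=> X'cl Y'cl XX' YY' [XY' nXY']; have Xcl := eq_perp_cl X'cl XX'.
have Ycl := eq_perp_cl Y'cl YY'; split.
  apply: commutes_eq_perp XX' _ => //; apply: commutes_sym => //.
  by apply: commutes_eq_perp YY' _ => //; exact: commutes_sym.
move=> XY; apply: nXY'; apply: nested_eq_perp XY => //; exact: eq_perp_sym.
Qed.

Lemma adjacent_eq_perp X X' Y Y' : ortho_closed X' -> ortho_closed Y' ->
  eq_perp X X' -> eq_perp Y Y' ->
  adjacent X' Y' -> adjacent X Y.
Proof.
move=> X'cl Y'cl XX' YY' [XYn XYs noTW]; split.
- exact: nested_eq_perp XYn.
- move=> XY; apply: XYs; apply: (eq_perp_trans Y'cl _ YY').
  apply: (eq_perp_trans (eq_perp_cl Y'cl YY') _ XY); exact: eq_perp_sym.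
move=> [T [W [[Tg Wg] TW [TWX TWY] [XT XW] [YT YW]]]]; apply: noTW.
have [Tcl Wcl] := (biinfinite_cl Tg, biinfinite_cl Wg).
have [Xcl Ycl] := (eq_perp_cl X'cl XX', eq_perp_cl Y'cl YY').
have [X'X Y'Y] := (eq_perp_sym X'cl XX', eq_perp_sym Y'cl YY').
have nestl A B Z : ortho_closed A -> ortho_closed Z ->
    eq_perp B A -> nested A Z -> nested B Z.
  by move=> Acl Zcl BA; apply: nested_eq_perp => //; left.
exists T, W; split=> //; split.
- exact: bicommutant_eq_perp X'X TWX.
- exact: bicommutant_eq_perp Y'Y TWY.
- exact: nestl X'X XT.
- exact: nestl X'X XW.
- exact: nestl Y'Y YT.
- exact: nestl Y'Y YW.
Qed.

(** Nothing fits strictly between X and its hyperplane X ∩ v⊥. *)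
Lemma nested_hyperplane X v T : biinfinite X -> X v -> v != 0 -> biinfinite T ->
  nested X T -> nested (X `&` vperp v) T ->
  exists2 T', eq_perp T' T &
    [\/ T' = X, T' `<=` X `&` vperp v | T' `<=` perp X].
Proof.
move=> Xg Xv v0 Tg XT YT; have [Xcl Tcl] := (biinfinite_cl Xg, biinfinite_cl Tg).
set Y := X `&` vperp v in YT *.
have Yg : biinfinite Y by exact: biinfinite_vperp.
have Ycl := biinfinite_cl Yg.
have [[T' TT' TX]|[T' TT' TX]] : (exists2 T', eq_perp T' T & T' `<=` perp X) \/
    (exists2 T', eq_perp T' T & T' `<=` X).
- case: XT => h; [left|left|right|right].
  + by exists (perp T); [right|exact: perpS].
  + by exists T; [left|exact: sub_perp_sym].
  + by exists (perp T); [right|exact: perp_sub_sym].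
  + by exists T; [left|exact: cl_sub].
- by exists T' => //; constructor 3.
exists T' => //; have T'g : biinfinite T' by exact: eq_perp_biinfinite TT'.
have T'cl := biinfinite_cl T'g; have [_ Tl _] := T'g.
have {}YT : nested Y T' by apply: nested_eq_perp YT => //; left.
case: YT => h.
- have [T'v|T'v] := pselect (T' v).
    constructor 1; apply/seteqP; split=> // x Xx.
    pose c := dot x v / dot v v; rewrite -[x](subrK (c *: v)).
    apply: clD => //; last exact: clZ.
    apply: h; split; first by apply: clB => //; exact: clZ.
    change (dot (x - c *: v) v = 0).
    by rewrite dotBl dotZl divfK ?subrr // dot_neq0.
  constructor 2 => x T'x; pose c := dot x v / dot v v.
  have Yx : Y (x - c *: v).
    split; first by apply: clB => //; [exact: TX|exact: clZ].
    change (dot (x - c *: v) v = 0).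
    by rewrite dotBl dotZl divfK ?subrr // dot_neq0.
  have [c0|c0] := eqVneq c 0; first by move: Yx; rewrite c0 scale0r subr0.
  case: T'v; rewrite -(scalerK c0 v); apply: clZ => //.
  by rewrite -[c *: v](subKr x); apply: clB => //; exact: h.
- have [x [[T'x xv] x0 _]] := large_vperp v Tl [::].
  case/eqP: x0; apply: (@perp_disj Y); first by split=> //; exact: TX.
  exact: sub_perp_sym T'x.
- have [_ _ /large_neq0[x Xx /eqP[]]] := Xg.
  apply: (perp_disj Xx); rewrite Xcl; apply: TX; apply: h.
  by apply: perpS Xx => y [].
- by constructor 2; exact: cl_sub.
Qed.

(** Up to complements, crossing subspaces T and W would both lie in Y = X ∩ v⊥,
    or both in X⊥.  Then T⊥ ∩ W⊥ is a piece of T and W that contains v together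
    with vectors separated from v by X, or by Y; this contradicts that X and Y
    lie in the bicommutant of T and W. *)
Lemma hyperplane_adjacent X v : biinfinite X -> X v -> v != 0 ->
  adjacent X (X `&` vperp v).
Proof.
move=> Xg Xv v0; have Xcl := biinfinite_cl Xg.
set Y := X `&` vperp v; have Yg : biinfinite Y by exact: biinfinite_vperp.
have YX : Y `<=` X by move=> ? [].
have Yperp_v : perp Y v by move=> y [_ yv]; exact: dotC.
have Yv : ~ Y v by move=> Yv; move/eqP: v0; apply; exact: perp_disj Yv _.
have [Ycl Yl _] := Yg; split.
- by constructor 4; exact: perpS.
- move=> [XY|XY]; first by apply: Yv; rewrite -XY.
  have [y Yy /eqP[]] := large_neq0 Yl.
  by apply: (perp_disj Yy); rewrite -XY; exact: YX.
move=> [T0 [W0 [[T0g W0g] TW0 [TWX0 TWY0] [XT0 XW0] [YT0 YW0]]]].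
have [T TT0 TP] := nested_hyperplane Xg Xv v0 T0g XT0 YT0.
have [W WW0 WP] := nested_hyperplane Xg Xv v0 W0g XW0 YW0.
have [T0cl W0cl] := (biinfinite_cl T0g, biinfinite_cl W0g).
have TW : crossing T W by exact: crossing_eq_perp TW0.
have TWX : bicommutant T W X.
  by apply: bicommutant_eq_perpl TT0 _ => //; exact: bicommutant_eq_perpr TWX0.
have TWY : bicommutant T W Y.
  by apply: bicommutant_eq_perpl TT0 _ => //; exact: bicommutant_eq_perpr TWY0.
have [Tg Wg] := (eq_perp_biinfinite T0g TT0, eq_perp_biinfinite W0g WW0).
have [Tcl Wcl] := (biinfinite_cl Tg, biinfinite_cl Wg).
have {}XT0 : nested X T by apply: nested_eq_perp XT0 => //; left.
have {}XW0 : nested X W by apply: nested_eq_perp XW0 => //; left.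
have notX : T <> X /\ W <> X.
  by split=> E; case: TW => _; apply; [rewrite E|apply: nested_sym => //; rewrite E].
have {TP}TP : T `<=` Y \/ T `<=` perp X by case: TP => //; [case: notX|left|right].
have {WP}WP : W `<=` Y \/ W `<=` perp X by case: WP => //; [case: notX|left|right].
have TW_side z S : biinfinite S -> bicommutant T W S -> T `<=` perp [set z] ->
    W `<=` perp [set z] -> side z S.
  move=> Sg TWS Tz Wz; apply: (bicommutant_side Tg Wg) => //; first by case: TW.
    by right; apply: (sub_perp_sym Tz).
  by right; apply: (sub_perp_sym Wz).
have sub_set1 A z : A `<=` perp [set z] <-> perp A z.
  split=> [/sub_perp_sym|zA]; first exact.
  by apply: sub_perp_sym => _ ->.
case: TP => TP; case: WP => WP.
(* v + u with u in X⊥ (resp. in Y) is on neither side of X (resp. of Y). *)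
- have [_ _ /large_neq0[u Xu /eqP u0]] := Xg.
  have [||Xvu|Xvu] := TW_side (v + u) X Xg TWX.
  + by apply/sub_set1; apply: perpD; [exact: (perpS TP)|exact: (perpS TP)(perpS YX Xu)].
  + by apply/sub_set1; apply: perpD; [exact: (perpS WP)|exact: (perpS WP)(perpS YX Xu)].
  + by apply: u0; apply: (perp_disj Xu); rewrite Xcl -[u](addKr v) addrC; exact: clB.
  + move/eqP: v0; apply; apply: (perp_disj Xv).
    by rewrite -[v](addrK u); exact: perpB.
- case: TW => _; apply; constructor 2; apply: subset_trans TP _.
  by apply: subset_trans YX _; exact: sub_perp_sym.
- case: TW => _; apply; constructor 2; apply: sub_perp_sym.
  by apply: subset_trans WP _; apply: subset_trans YX _; exact: sub_perp_sym.
- have [u Yu /eqP u0] := large_neq0 Yl.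
  have pXX z : X z -> perp (perp X) z by rewrite Xcl.
  have [||Yvu|Yvu] := TW_side (v + u) Y Yg TWY.
  + by apply/sub_set1; apply: perpD; apply: (perpS TP); apply: pXX => //; exact: YX.
  + by apply/sub_set1; apply: perpD; apply: (perpS WP); apply: pXX => //; exact: YX.
  + by apply: Yv; rewrite -[v](addrK u); exact: clB.
  + by apply: u0; apply: (perp_disj Yu); rewrite -[u](addKr v) addrC; exact: perpB.
Qed.

(** If X ∩ Y⊥ contained e and a vector orthogonal to e, then X ∩ e⊥ and Y + e
    would be two crossing subspaces with intersection Y and sum X. *)
Lemma adjacent_hyperplane X Y : biinfinite X -> biinfinite Y -> Y `<=` X ->
  adjacent X Y ->
  exists v, [/\ X v, v != 0 & Y = X `&` vperp v].
Proof.
move=> Xg Yg YX [_ XY noTW]; have [Xcl Ycl] := (biinfinite_cl Xg, biinfinite_cl Yg).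
have [e [Xe Ye e0]] : exists e, [/\ X e, perp Y e & e != 0].
  apply: contrapT => /forallNP noe; apply: XY; left; apply/seteqP; split=> // x Xx.
  have [y Yy Yxy] := cl_split x Ycl.
  have [/eqP|xy0] := eqVneq (x - y) 0; first by rewrite subr_eq0 => /eqP ->.
  by case: (noe (x - y)); split=> //; apply: clB => //; exact: YX.
exists e; split=> //; apply/seteqP; split=> [y Yy|u [Xu ue]].
  by split; [exact: YX|apply: dotC; apply: Ye].
apply: contrapT => Yu; apply: noTW.
set T := X `&` vperp e; pose W := perp (perp Y `&` vperp e).
have Tg : biinfinite T by exact: biinfinite_vperp.
have pWE : perp W = perp Y `&` vperp e.
  by apply: clI; [exact: perp_cl|exact: vperp_cl].
have Wg : biinfinite W by apply/biinfinite_perp/biinfinite_vperp/biinfinite_perp.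
have [Tcl Wcl] := (biinfinite_cl Tg, biinfinite_cl Wg).
have TX : T `<=` X by move=> ? [].
have YT : Y `<=` T by move=> y Yy; split; [exact: YX|apply: dotC; apply: Ye].
have YW : Y `<=` W by apply: sub_perp_sym => ? [].
have WX : W `<=` X.
  apply: cl_sub => //; rewrite pWE => x Xx; split; first exact: perpS Xx.
  exact: Xx.
have We : W e by move=> x [_ xe]; apply: dotC.
have pTe : perp T e by move=> x [_ xe]; apply: dotC.
have TWY (t : V) : T t -> W t -> Y t.
  move=> Tt Wt; have [y Yy Yty] := cl_split t Ycl.
  have /eqP : t - y = 0; last by rewrite subr_eq0 => /eqP ->.
  apply: (@perp_disj W); first by apply: (clB Wcl) => //; exact: YW.
  rewrite pWE; split=> //; suff : T (t - y) by case.
  by apply: (clB Tcl) => //; exact: YT.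
exists T, W; split=> //.
- split.
    apply: commutes_sym => //; apply: commutes_perpl => //.
    apply: commutesIl => //; first by apply: commutes_perpl => //; exact: commutes_sub.
    by apply: commutes_vperp => //; right.
  have Tu : T u by split.
  case=> h.
  + by apply: Yu; apply: TWY => //; exact: h.
  + have [_ /large_neq0[y Yy /eqP y0] _] := Yg; apply: y0.
    by apply: (perp_disj (YW y Yy)); apply: h; exact: YT.
  + have [_ _ /large_neq0[x Xx /eqP[]]] := Xg.
    apply: (perp_disj Xx); rewrite Xcl; apply: WX; apply: h; exact: perpS Xx.
  + by move/eqP: e0; apply; apply: (perp_disj We); exact: h.
- split=> Z Zg ZT ZW; have Zcl := biinfinite_cl Zg; last first.
    have -> : Y = T `&` W.
      by apply/seteqP; split=> [y Yy|t []]; [split; [exact: YT|exact: YW]|exact: TWY].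
    by apply: commutes_sym; [exact: clI|..|apply: commutesIl => //; exact: commutes_sym].
  apply/commutes_perprE => //.
  have -> : perp X = perp T `&` perp W.
    apply/seteqP; split=> [x Xx|z [Tz Wz] x Xx].
      by split; apply: perpS Xx.
    pose c := dot x e / dot e e; rewrite -[x](subrK (c *: e)).
    apply: dotDr; last by apply: dotZr; apply: Wz.
    apply: Tz; split; first by apply: clB => //; exact: clZ.
    change (dot (x - c *: e) e = 0).
    by rewrite dotBl dotZl divfK ?subrr // dot_neq0.
  apply: commutes_sym => //; first by apply: clI; exact: perp_cl.
  by apply: commutesIl => //; apply: commutes_perpl => //; exact: commutes_sym.
- by split; constructor 4; exact: perpS.
- by split; constructor 1.
Qed.

Lemma adjacent_differ_by X Y : biinfinite X -> biinfinite Y -> adjacent X Y ->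
  exists v, differ_by v X Y.
Proof.
move=> Xg Yg XY; have [Xcl Ycl] := (biinfinite_cl Xg, biinfinite_cl Yg).
have [X' [Y' [X'X Y'Y Y'X']]] : exists X' Y',
    [/\ eq_perp X' X, eq_perp Y' Y & Y' `<=` X'].
  case: XY => -[] h _ _.
  - by exists (perp X), (perp Y); split; [right|right|exact: perpS].
  - by exists (perp X), Y; split; [right|left|exact: sub_perp_sym].
  - by exists X, (perp Y); split; [left|right|exact: perp_sub_sym].
  - by exists X, Y; split; [left|left|exact: cl_sub].
have [X'g Y'g] := (eq_perp_biinfinite Xg X'X, eq_perp_biinfinite Yg Y'Y).
have [|v [X'v v0 Y'E]] := adjacent_hyperplane X'g Y'g Y'X'.
  exact: adjacent_eq_perp XY.
exists v; split=> //; exists X', Y'; split=> //; try exact: eq_perp_sym.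
exact: biinfinite_cl.
Qed.

Lemma differ_by_adjacent v X Y : biinfinite X -> biinfinite Y ->
  differ_by v X Y ->
  adjacent X Y.
Proof.
move=> Xg Yg [v0 [X' [Y' [XX' YY' X'cl X'v Y'E]]]].
have X'g : biinfinite X' by apply: eq_perp_biinfinite Xg _; exact: eq_perp_sym.
have Y'g : biinfinite Y' by rewrite Y'E; exact: biinfinite_vperp.
apply: adjacent_eq_perp XX' YY' _ => //; first exact: biinfinite_cl.
by rewrite Y'E; exact: hyperplane_adjacent.
Qed.

(** * Orthogonal infinite-dimensional subspaces *)

Lemma dot_suml n (c : 'I_n -> K) (x : 'I_n -> V) w :
  dot (\sum_i c i *: x i) w = \sum_i c i * dot (x i) w.
Proof.
elim/big_rec2: _ => [|i a b _ <-]; first exact: dot0l.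
by rewrite dotDl dotZl.
Qed.

(** Finitely many linear conditions on n + 1 orthogonal vectors leave a nonzero
    combination when there are n of them. *)
Lemma large_orthogonal_sequence X (x : nat -> V) : ortho_closed X ->
  (forall n, X (x n)) -> (forall n, x n != 0) ->
  (forall m n : nat, m != n -> dot (x m) (x n) = 0) -> large X.
Proof.
move=> Xcl Xx x0 xx s.
pose M := \matrix_(i < (size s).+1, j < size s) dot (x i) s`_j.
have /rowV0Pn[c /sub_kermxP cM c0] : kermx M != 0.
  by rewrite -mxrank_eq0 mxrank_ker -lt0n subn_gt0 ltnS rank_leq_col.
pose u := \sum_(i < (size s).+1) c 0 i *: x i.
have ux (i : 'I_(size s).+1) : dot u (x i) = c 0 i * dot (x i) (x i) :> K.
  rewrite dot_suml (bigD1 i) //= big1 ?addr0 // => j ji.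
  by rewrite xx ?mulr0.
exists u; split.
- rewrite /u; elim/big_ind: _ => [|a b|i _]; first exact: cl0.
    exact: clD.
  exact: clZ.
- have [i ci] : exists i, c 0 i != 0.
    apply/existsP; apply: contraNT c0 => /existsPn ci; apply/eqP/rowP => i.
    by rewrite mxE; apply/eqP; have := ci i; rewrite negbK.
  apply/eqP => u0; have := ux i; rewrite u0 dot0l => /esym/eqP.
  by rewrite mulf_eq0 (negPf ci) (negPf (dot_neq0 (x0 i))).
- move=> y ys; have js : (index y s < size s)%N by rewrite index_mem.
  have /rowP/(_ (Ordinal js)) := cM; rewrite !mxE => <-.
  rewrite dot_suml; apply: eq_bigr => i _.
  by rewrite mxE /= nth_index.
Qed.

(** The vectors x n in X and z n in Z are chosen alternately, each orthogonal to
    all earlier ones; P and Q are their closed spans. *)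
Lemma orthogonal_large_pair X Z : ortho_closed X -> ortho_closed Z ->
  large X -> large Z ->
  exists P Q, [/\ [/\ ortho_closed P, large P & P `<=` X],
                  [/\ ortho_closed Q, large Q & Q `<=` Z] & P `<=` perp Q].
Proof.
move=> Xcl Zcl /choice[nx nxP] /choice[nz nzP].
pose step s := [:: nz (nx s :: s), nx s & s].
pose F n := iter n step [::].
pose x n := nx (F n); pose z n := nz (x n :: F n).
have FS n : F n.+1 = [:: z n, x n & F n] by [].
have memF m n : (m < n)%N -> x m \in F n /\ z m \in F n.
  elim: n => // n IHn; rewrite ltnS leq_eqVlt FS => /predU1P[->|/IHn[xm zm]].
    by rewrite !inE !eqxx ?orbT.
  by rewrite !inE xm zm !orbT.
have xx m n : m != n -> dot (x m) (x n) = 0.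
  wlog mn : m n / (n < m)%N => [th nm|_].
    case: (ltngtP m n) => [lt_mn|/th|/eqP]; last by rewrite (negPf nm).
      by apply: dotC; apply: th => //; rewrite eq_sym.
    exact.
  by have [_ _] := nxP (F m); apply; case: (memF _ _ mn).
have zz m n : m != n -> dot (z m) (z n) = 0.
  wlog mn : m n / (n < m)%N => [th nm|_].
    case: (ltngtP m n) => [lt_mn|/th|/eqP]; last by rewrite (negPf nm).
      by apply: dotC; apply: th => //; rewrite eq_sym.
    exact.
  have [_ _] := nzP (x m :: F m); apply.
  by rewrite inE; case: (memF _ _ mn) => _ ->; rewrite orbT.
have xz m n : dot (x m) (z n) = 0.
  have [nm|mn] := ltnP n m.
    by have [_ _] := nxP (F m); apply; case: (memF _ _ nm).
  apply: dotC; have [_ _] := nzP (x n :: F n); apply.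
  rewrite inE; move: mn; rewrite leq_eqVlt => /predU1P[->|]; first by rewrite eqxx.
  by case/memF => -> _; rewrite orbT.
have rx n : X (x n) by case: (nxP (F n)).
have rz n : Z (z n) by case: (nzP (x n :: F n)).
have hull A (y : nat -> V) : ortho_closed A -> (forall n, A (y n)) ->
    perp (perp (range y)) `<=` A.
  by move=> {2}<- Ay; do 2 apply: perpS; move=> _ [n _ <-].
have hull_in (y : nat -> V) n : perp (perp (range y)) (y n).
  by apply: sub_perpK; exists n.
exists (perp (perp (range x))), (perp (perp (range z))); split.
- split; [exact: perp_cl| |exact: hull].
  apply: (@large_orthogonal_sequence _ x) => //; first exact: perp_cl.
  by move=> n; case: (nxP (F n)).
- split; [exact: perp_cl| |exact: hull].
  apply: (@large_orthogonal_sequence _ z) => //; first exact: perp_cl.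
  by move=> n; case: (nzP (x n :: F n)).
- rewrite (perp_cl (range z)); apply: hull; first exact: perp_cl.
  by move=> n _ [m _ <-]; exact: xz.
Qed.

(** The closed sum of X and the line of v. *)
Definition extend X v := perp (perp X `&` vperp v).

Lemma extend_cl X v : ortho_closed (extend X v). Proof. exact: perp_cl. Qed.

Lemma perp_extend X v : perp (extend X v) = perp X `&` vperp v.
Proof. by apply: clI; [exact: perp_cl|exact: vperp_cl]. Qed.

Lemma extend_in X v : extend X v v.
Proof. by move=> x [_ xv]; exact: dotC. Qed.

Lemma extend_sup X v : X `<=` extend X v.
Proof. by apply: sub_perp_sym => ? []. Qed.

Lemma extend_sub X Y v : ortho_closed Y -> X `<=` Y -> Y v -> extend X v `<=` Y.
Proof.
move=> Ycl XY Yv; apply: cl_sub => //; rewrite perp_extend => y Yy.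
by split; [exact: perpS Yy|exact: Yy].
Qed.

Lemma extend_vperp X v : ortho_closed X -> X `<=` vperp v ->
  extend X v `&` vperp v = X.
Proof.
move=> Xcl Xv; apply/seteqP; split=> [u [uX uv]|x Xx]; last first.
  by split; [exact: extend_sup|exact: Xv].
have [p Xp Xup] := cl_split u Xcl.
have pv : vperp v (u - p) by apply: clB => //; [exact: vperp_cl|exact: Xv].
have /eqP : u - p = 0; last by rewrite subr_eq0 => /eqP ->.
apply: (form_anisotropic dotP); rewrite {1}dotBl uX ?sub0r; last by split.
by rewrite (dotC (Xup p Xp)) oppr0.
Qed.

(** * Correspondences that preserve commutation *)

(** A bijection preserving commutation acts on subspaces up to complement only.
    A relation closed under complements on both sides makes the choice of
    representatives free, and its converse is of the same kind, so that each
    statement below is needed in one direction only. *)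
Record correspondence (F : set V -> set V -> Prop) : Prop := Correspondence {
  corr_biinfinite : forall X X', F X X' -> biinfinite X /\ biinfinite X';
  corr_total : forall X, biinfinite X -> exists X', F X X';
  corr_onto : forall X', biinfinite X' -> exists X, F X X';
  corr_perpl : forall X X', F X X' -> F (perp X) X';
  corr_perpr : forall X X', F X X' -> F X (perp X');
  corr_commutes : forall X X' Y Y', F X X' -> F Y Y' ->
    commutes X Y <-> commutes X' Y' }.

Definition converse (F : set V -> set V -> Prop) X Y := F Y X.

Lemma converse_correspondence F : correspondence F ->
  correspondence (converse F).
Proof.
case=> h1 h2 h3 h4 h5 h6; split=> //.
- by move=> X X' /h1[].
- by move=> X X'; exact: h5.
- by move=> X X'; exact: h4.
- by move=> X X' Y Y' FX FY; exact: iff_sym (h6 _ _ _ _ FX FY).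
Qed.

Section Transport.
Variable F : set V -> set V -> Prop.
Hypothesis cF : correspondence F.
Variables (X X' Y Y' : set V).
Hypotheses (FX : F X X') (FY : F Y Y').

Lemma bicommutant_corr S S' : F S S' -> bicommutant X Y S ->
  bicommutant X' Y' S'.
Proof.
move=> FS XYS Z' Z'g Z'X' Z'Y'; have [Z FZ] := corr_onto cF Z'g.
have [Zg _] := corr_biinfinite cF FZ; apply/(corr_commutes cF FZ FS).
by apply: XYS => //; [apply/(corr_commutes cF FZ FX)|apply/(corr_commutes cF FZ FY)].
Qed.

Lemma eq_perp_corr : eq_perp X Y -> eq_perp X' Y'.
Proof.
have [Xg X'g] := corr_biinfinite cF FX; have [Yg Y'g] := corr_biinfinite cF FY.
move=> /(bicommutant_eq_perpP Yg Xg) XY; apply/(bicommutant_eq_perpP Y'g X'g).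
move=> Z' Z'g Z'Y' _; have [Z FZ] := corr_onto cF Z'g.
have [Zg _] := corr_biinfinite cF FZ; apply/(corr_commutes cF FZ FX).
by apply: XY => //; apply/(corr_commutes cF FZ FY).
Qed.

End Transport.

Lemma nested_corr F X X' Y Y' : correspondence F -> F X X' -> F Y Y' ->
  nested X Y -> nested X' Y'.
Proof.
move=> cF FX FY; have [Xg X'g] := corr_biinfinite cF FX.
have [Yg Y'g] := corr_biinfinite cF FY.
move=> /(nestedP Xg Yg)[XY [E Eg XYE]]; apply/nestedP => //.
split; first exact/(corr_commutes cF FX FY).
have [E' FE] := corr_total cF Eg; exists E'; first by case: (corr_biinfinite cF FE).
move=> S' S'g X'Y'S'; have [S FS] := corr_onto cF S'g.
have [Sg _] := corr_biinfinite cF FS.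
have XYS : bicommutant X Y S.
  by apply: (bicommutant_corr (converse_correspondence cF)) X'Y'S'.
case: (XYE S Sg XYS) => h.
- by constructor 1; exact: (eq_perp_corr cF FS FX).
- by constructor 2; exact: (eq_perp_corr cF FS FY).
- by constructor 3; exact: (eq_perp_corr cF FS FE).
Qed.

Lemma nested_corrE F X X' Y Y' : correspondence F -> F X X' -> F Y Y' ->
  nested X Y <-> nested X' Y'.
Proof.
move=> cF FX FY; split; first exact: (nested_corr cF).
exact: (nested_corr (converse_correspondence cF)).
Qed.

Lemma eq_perp_corrE F X X' Y Y' : correspondence F -> F X X' -> F Y Y' ->
  eq_perp X Y <-> eq_perp X' Y'.
Proof.
move=> cF FX FY; split; first exact: (eq_perp_corr cF).
exact: (eq_perp_corr (converse_correspondence cF)).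
Qed.

Lemma crossing_corrE F X X' Y Y' : correspondence F -> F X X' -> F Y Y' ->
  crossing X Y <-> crossing X' Y'.
Proof.
move=> cF FX FY; have nE := nested_corrE cF FX FY.
have cE := corr_commutes cF FX FY.
by split=> -[/cE XY nXY]; split=> // /nE.
Qed.

Lemma adjacent_corr F X X' Y Y' : correspondence F -> F X X' -> F Y Y' ->
  adjacent X Y -> adjacent X' Y'.
Proof.
move=> cF FX FY [XY nXY noTW].
have cF' := converse_correspondence cF; split.
- exact: (nested_corr cF FX FY).
- by move=> h; apply: nXY; apply/(eq_perp_corrE cF FX FY).
move=> [T' [W' [[T'g W'g] TW [ccX ccY] [XT XW] [YT YW]]]]; apply: noTW.
have [T FT] := corr_onto cF T'g; have [W FW] := corr_onto cF W'g.
have [[Tg _] [Wg _]] := (corr_biinfinite cF FT, corr_biinfinite cF FW).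
exists T, W; split=> //; first exact/(crossing_corrE cF FT FW).
- by split; [exact: (bicommutant_corr cF') ccX|exact: (bicommutant_corr cF') ccY].
- by split; [exact/(nested_corrE cF FX FT)|exact/(nested_corrE cF FX FW)].
- by split; [exact/(nested_corrE cF FY FT)|exact/(nested_corrE cF FY FW)].
Qed.

(** * Parallel transport of a line *)

Lemma differ_by_eq_perp v X X1 Y Y1 : ortho_closed X1 -> ortho_closed Y1 ->
  eq_perp X X1 -> eq_perp Y Y1 ->
  differ_by v X1 Y1 -> differ_by v X Y.
Proof.
move=> X1cl Y1cl XX1 YY1 [v0 [X2 [Y2 [X12 Y12 X2cl X2v Y2E]]]].
have Y2cl : ortho_closed Y2 by rewrite Y2E; apply: clI => //; exact: vperp_cl.
split=> //; exists X2, Y2; split=> //.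
  exact: eq_perp_trans XX1 X12.
exact: eq_perp_trans YY1 Y12.
Qed.

Lemma hyperplane_differ_by v X : ortho_closed X -> X v -> v != 0 ->
  differ_by v X (X `&` vperp v).
Proof.
move=> Xcl Xv v0; split=> //; exists X, (X `&` vperp v).
by split=> //; left.
Qed.

Lemma extend_hyperplane X v : ortho_closed X -> X v -> v != 0 ->
  perp (X `&` vperp v) `&` vperp v = perp X.
Proof.
move=> Xcl Xv v0; rewrite -{1}Xcl; apply: extend_vperp; first exact: perp_cl.
by move=> x; exact.
Qed.

Lemma differ_by_sym v X Y : ortho_closed X -> ortho_closed Y ->
  differ_by v X Y -> differ_by v Y X.
Proof.
move=> Xcl Ycl [v0 [X' [Y' [XX' YY' X'cl X'v Y'E]]]].
have Y'cl : ortho_closed Y' by rewrite Y'E; apply: clI => //; exact: vperp_cl.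
split=> //; exists (perp Y'), (perp X'); split.
- by apply: eq_perp_trans YY' _; [exact: perp_cl|right].
- by apply: eq_perp_trans XX' _; [exact: perp_cl|right].
- exact: perp_cl.
- by rewrite Y'E => y [_ yv]; exact: dotC.
- by rewrite Y'E extend_hyperplane.
Qed.

Lemma differ_by_side v X Y Z : ortho_closed X -> ortho_closed Y ->
  ortho_closed Z -> differ_by v X Y ->
  commutes X Z -> commutes Y Z -> side v Z.
Proof.
move=> Xcl Ycl Zcl [v0 [X' [Y' [XX' YY' X'cl X'v Y'E]]]] XZ YZ.
apply: (side_of_commutes X'cl Zcl X'v v0).
  by apply: commutes_eq_perp XZ => //; exact: eq_perp_sym.
have Y'cl : ortho_closed Y' by rewrite Y'E; apply: clI => //; exact: vperp_cl.
by rewrite -Y'E; apply: commutes_eq_perp YZ => //; exact: eq_perp_sym.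
Qed.

(** The image pair is adjacent, hence differs by some line. *)
Lemma differ_by_corr F X X' Y Y' v : correspondence F -> F X X' -> F Y Y' ->
  differ_by v X Y -> exists w, differ_by w X' Y'.
Proof.
move=> cF FX FY XY; have [Xg X'g] := corr_biinfinite cF FX.
have [Yg Y'g] := corr_biinfinite cF FY; apply: adjacent_differ_by => //.
by apply: (adjacent_corr cF FX FY); exact: differ_by_adjacent XY.
Qed.

(** Choose complements so that Z is included in X; then w lies in Z, as Z
    crosses X ∩ w⊥.  If W is a hyperplane of Z, being nested with X ∩ w⊥ makes
    it Z ∩ w⊥.  If W⊥ is Z enlarged by a line, being nested with X ∩ w⊥ makes
    it X, which is excluded. *)
Lemma parallel_hyperplane w X Z W w' : biinfinite X -> X w -> w != 0 ->
  biinfinite Z -> biinfinite W -> differ_by w' Z W -> nested X Z ->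
  ~ eq_perp X Z -> ~ eq_perp X W ->
  crossing (X `&` vperp w) Z -> nested (X `&` vperp w) W ->
  differ_by w Z W.
Proof.
move=> Xg Xw w0 Zg Wg [w'0 [Z2 [W2 [ZZ2 WW2 Z2cl Z2w' W2E]]]].
set Y := X `&` vperp w => XZ nXZ nXW [YZ nYZ] YW.
have [Xcl Zcl] := (biinfinite_cl Xg, biinfinite_cl Zg); have Wcl := biinfinite_cl Wg.
have Yg : biinfinite Y by exact: biinfinite_vperp.
have Ycl := biinfinite_cl Yg; have YX : Y `<=` X by move=> ? [].
have W2cl : ortho_closed W2 by rewrite W2E; apply: clI => //; exact: vperp_cl.
have Yw : perp Y w by move=> y [_ yw]; exact: dotC.
have [Z1 Z1Z Z1X] : exists2 Z1, eq_perp Z1 Z & Z1 `<=` X.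
  case: XZ => h; first by case: nYZ; constructor 1; exact: subset_trans h.
  - by case: nYZ; constructor 2; exact: subset_trans h.
  - by exists (perp Z); [right|exact: perp_sub_sym].
  - by exists Z; [left|exact: cl_sub].
have Z1g := eq_perp_biinfinite Zg Z1Z; have Z1cl := biinfinite_cl Z1g.
have ZZ1 := eq_perp_sym Zcl Z1Z.
have Z2Z1 : eq_perp Z2 Z1 by apply: eq_perp_trans (eq_perp_sym Z2cl ZZ2) ZZ1.
have {}nXZ : ~ eq_perp X Z1 by move=> h; apply: nXZ; exact: eq_perp_trans h Z1Z.
have nXW2 : ~ eq_perp X W2.
  by move=> h; apply: nXW; apply: eq_perp_trans h (eq_perp_sym W2cl WW2).
have nYZ1 : ~ nested Y Z1.
  by move=> h; apply: nYZ; apply: nested_eq_perp h => //; left.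
have YW2 : nested Y W2.
  by apply: nested_eq_perp YW => //; [left|exact: eq_perp_sym].
have Z1w : Z1 w.
  have XZ1 : commutes X Z1 by apply: commutes_sym => //; exact: commutes_sub.
  have YZ1 : commutes Y Z1.
    by apply: commutes_sym => //; apply: commutes_eq_perp Z1Z _ => //; exact: commutes_sym.
  have [//|Z1w] := side_of_commutes Xcl Z1cl Xw w0 XZ1 YZ1.
  case: nYZ1; constructor 4; apply: perpS => z Z1z.
  by split; [exact: Z1X|apply: dotC; apply: Z1w].
have [_ _ /large_vperp pXl] := Xg.
case: Z2Z1 => Z2E; rewrite {Z2}Z2E in ZZ2 Z2cl Z2w' W2E *.
- have W2Z1 : W2 `<=` Z1 by rewrite W2E => ? [].
  have W2g : biinfinite W2 by rewrite W2E; exact: biinfinite_vperp.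
  have [_ W2l _] := W2g.
  case: YW2 => h.
  + by case: nYZ1; constructor 1; exact: subset_trans W2Z1.
  + have [x [[W2x xw] /eqP x0 _]] := large_vperp w W2l [::].
    case: x0; apply: (perp_disj W2x); apply: h.
    by split=> //; apply/Z1X/W2Z1.
  + have [_ _ /large_neq0[x Xx /eqP x0]] := Xg; case: x0.
    apply: (perp_disj Xx); rewrite Xcl; apply/Z1X/W2Z1/h; exact: perpS Xx.
  + have W2Y : W2 `<=` Y by exact: cl_sub.
    have [c wE] : exists c, w = c *: w'.
      apply: (line_in Z1cl) => // x xZ1; apply: Yw; apply: W2Y.
      by rewrite W2E.
    apply: differ_by_eq_perp ZZ1 WW2 _ => //; rewrite W2E.
    suff -> : Z1 `&` vperp w' = Z1 `&` vperp w by exact: hyperplane_differ_by.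
    have c0 : c != 0 by apply: contra_neq w0 => c0; rewrite wE c0 scale0r.
    apply/seteqP; split=> x [Z1x xw]; split=> //.
      by rewrite wE; exact: dotZr.
    by rewrite -[w'](scalerK c0) -wE; exact: dotZr.
- have W2Z1 : W2 `<=` perp Z1 by rewrite W2E => ? [].
  case: YW2 => h.
  + by case: nYZ1; constructor 2; exact: subset_trans W2Z1.
  + case: nXW2; right; apply/seteqP; split.
      move=> x Xx; pose c := dot x w / dot w w; rewrite -[x](subrK (c *: w)).
      apply: perpD; last by apply/perpZ/(perpS W2Z1)/sub_perpK.
      apply: h; split; first by apply: clB => //; exact: clZ.
      change (dot (x - c *: w) w = 0).
      by rewrite dotBl dotZl divfK ?subrr // dot_neq0.
    have Xw' : X w'.
      have [d [Xd Z1d d0]] : exists d, [/\ X d, perp Z1 d & d != 0].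
        apply: contrapT => /forallNP nod; apply: nXZ; left.
        apply/seteqP; split=> // x Xx; have [z Z1z Z1xz] := cl_split x Z1cl.
        have [/eqP|xz0] := eqVneq (x - z) 0; first by rewrite subr_eq0 => /eqP ->.
        by case: (nod (x - z)); split=> //; apply: clB => //; exact: Z1X.
      have [c dE] : exists c, d = c *: w'.
        apply: (line_in Z2cl) => //; rewrite -W2E.
        pose k := dot d w / dot w w; rewrite -[d](subrK (k *: w)).
        apply: perpD; last by apply/perpZ/(perpS W2Z1)/sub_perpK.
        apply: h; split; first by apply: clB => //; exact: clZ.
        change (dot (d - k *: w) w = 0).
        by rewrite dotBl dotZl divfK ?subrr // dot_neq0.
      have c0 : c != 0 by apply: contra_neq d0 => c0; rewrite dE c0 scale0r.
      by rewrite -[w'](scalerK c0) -dE; exact: clZ.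
    apply: cl_sub => // x Xx; rewrite W2cl W2E; split; first exact: perpS Xx.
    exact: Xx.
  + case/eqP: w0; apply: (perp_disj Z1w); apply: W2Z1; exact: h.
  + have W2Y : W2 `<=` Y by exact: cl_sub.
    have [x [[Xx xw'] /eqP x0 _]] := pXl w' [::]; case: x0.
    apply: (perp_disj Xx); rewrite Xcl; apply: YX; apply: W2Y.
    by rewrite W2E; split=> //; exact: perpS Xx.
Qed.

(** Unless Z = X, the hypotheses of [parallel_hyperplane] hold for X, Z,
    X ∩ v⊥ and W = Z ∩ v⊥, and they are invariant under a correspondence. *)
Lemma corr_parallel F X X' Y' Z Z' W' v w : correspondence F ->
  biinfinite X -> Z `<=` X -> Z v -> v != 0 -> F X X' -> F (X `&` vperp v) Y' ->
  F Z Z' -> F (Z `&` vperp v) W' -> differ_by w X' Y' -> differ_by w Z' W'.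
Proof.
move=> cF Xg ZX Zv v0; set Y := X `&` vperp v; set W := Z `&` vperp v.
move=> FX FY FZ FW XYw; have Xcl := biinfinite_cl Xg; have Xv := ZX v Zv.
have [_ X'g] := corr_biinfinite cF FX; have [Yg Y'g] := corr_biinfinite cF FY.
have [Zg Z'g] := corr_biinfinite cF FZ; have [Wg W'g] := corr_biinfinite cF FW.
have [X'cl Y'cl] := (biinfinite_cl X'g, biinfinite_cl Y'g); have Zcl := biinfinite_cl Zg.
have Ycl := biinfinite_cl Yg.
have [ZE|nZX] := pselect (Z = X).
  apply: differ_by_eq_perp XYw => //.
    by apply: (eq_perp_corr cF FZ FX); left.
  by apply: (eq_perp_corr cF FW FY); left; rewrite /W ZE.
have WZ : W `<=` Z by move=> ? [].
have WY : W `<=` Y by move=> u [Zu uv]; split=> //; exact: ZX.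
have Wneq0 : exists2 u, W u & u != 0 by case: Wg => _ /large_neq0.
have [w' ZWw'] : exists w', differ_by w' Z' W'.
  by apply: (differ_by_corr cF FZ FW); exact: hyperplane_differ_by.
have XYnXZ : ~ eq_perp X Z.
  move=> [XZ|XZ]; first exact: nZX.
  have [u Wu /eqP u0] := Wneq0; apply: u0.
  by apply: (perp_disj (WZ u Wu)); rewrite -XZ; apply/ZX/WZ.
have nXW : ~ eq_perp X W.
  move=> [XW|XW].
    have /(perp_disj) : W v by rewrite -XW.
    move=> Wv; case/eqP: v0; apply: Wv => u [_ uv]; exact: dotC.
  have [u Wu /eqP u0] := Wneq0; apply: u0.
  by apply: (perp_disj Wu); rewrite -XW; apply/ZX/WZ.
have YZ : crossing Y Z.
  split.
    apply: commutesIl => //; first by apply: commutes_sym => //; exact: commutes_sub.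
    by apply: commutes_vperp => //; left.
  have [x [Xx Zx x0]] : exists x, [/\ X x, perp Z x & x != 0].
    apply: contrapT => /forallNP nox; apply: nZX.
    apply/seteqP; split=> // x Xx; have [z Zz Zxz] := cl_split x Zcl.
    have [/eqP|xz0] := eqVneq (x - z) 0; first by rewrite subr_eq0 => /eqP ->.
    by case: (nox (x - z)); split=> //; apply: clB => //; exact: ZX.
  have Yx : Y x by split=> //; exact: Zx.
  case=> h.
  + by case/eqP: x0; apply: (perp_disj (h x Yx)).
  + have [u Wu /eqP u0] := Wneq0; apply: u0.
    by apply: (perp_disj (WZ u Wu)); apply: h; exact: WY.
  + have [_ _ /large_neq0[u Xu /eqP u0]] := Xg; apply: u0.
    apply: (perp_disj Xu); rewrite Xcl; apply/ZX/h.
    by apply: perpS Xu => ? [].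
  + have [_ vv] : Y v by exact: (cl_sub Ycl h).
    by have := dot_neq0 v0; rewrite (vv : dot v v = 0) eqxx.
have [_ [X1 [Y1 [XX1 YY1 X1cl X1w Y1E]]]] := XYw.
have w0 : w != 0 by case: XYw.
have X1X' := eq_perp_sym X1cl XX1.
have X1g := eq_perp_biinfinite X'g X1X'.
have Y1cl : ortho_closed Y1 by rewrite Y1E; apply: clI => //; exact: vperp_cl.
have Y1Y' := eq_perp_sym Y1cl YY1.
have Z'cl := biinfinite_cl Z'g; have W'cl := biinfinite_cl W'g.
apply: (parallel_hyperplane X1g X1w w0) ZWw' _ _ _ _ _ => //.
- apply: (nested_eq_perp X'cl Z'cl X1X' (or_introl erefl)).
  by apply: (nested_corr cF FX FZ); constructor 4; exact: perpS.
- move=> X1Z'; apply: XYnXZ; apply/(eq_perp_corrE cF FX FZ).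
  exact: eq_perp_trans XX1 X1Z'.
- move=> X1W'; apply: nXW; apply/(eq_perp_corrE cF FX FW).
  exact: eq_perp_trans XX1 X1W'.
- rewrite -Y1E; apply: (crossing_eq_perp Y'cl Z'cl Y1Y' (or_introl erefl)).
  exact/(crossing_corrE cF FY FZ).
- rewrite -Y1E; apply: (nested_eq_perp Y'cl W'cl Y1Y' (or_introl erefl)).
  by apply: (nested_corr cF FY FW); constructor 4; exact: perpS.
Qed.

(** The pair (X, X ∩ v⊥) is transported to (P + v, P), read as (P⊥, P⊥ ∩ v⊥),
    and from there to (Q + v, Q), both of whose members commute with Z. *)
Lemma differ_by_transport_hyperplane F v X X' Y' Z Z' w : correspondence F ->
  biinfinite X -> X v -> v != 0 -> F X X' -> F (X `&` vperp v) Y' ->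
  differ_by w X' Y' -> F Z Z' -> Z v -> side w Z'.
Proof.
move=> cF Xg Xv v0 FX FY XYw FZ Zv; have [Xcl Xl pXl] := Xg.
have [[Zcl Zl pZl] Z'g] := corr_biinfinite cF FZ.
have [P [Q [[Pcl Pl PX] [Qcl Ql QZ] PQ]]] :=
  orthogonal_large_pair (clI Xcl (vperp_cl v)) (clI Zcl (vperp_cl v))
    (large_vperp v Xl) (large_vperp v Zl).
have Pv : P `<=` vperp v by move=> p /PX[].
have Qv : Q `<=` vperp v by move=> q /QZ[].
have P1X : extend P v `<=` X by apply: extend_sub => // p /PX[].
have Q1Z : extend Q v `<=` Z by apply: extend_sub => // q /QZ[].
have Pg : biinfinite P by apply: (biinfinite_between _ _ Pl pXl) => // p /PX[].
have Qg : biinfinite Q by apply: (biinfinite_between _ _ Ql pZl) => // q /QZ[].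
have P1g : biinfinite (extend P v).
  exact: (biinfinite_between (@extend_sup P v) P1X Pl pXl (extend_cl P v)).
have Q1g : biinfinite (extend Q v).
  exact: (biinfinite_between (@extend_sup Q v) Q1Z Ql pZl (extend_cl Q v)).
have P1E := extend_vperp Pcl Pv; have Q1E := extend_vperp Qcl Qv.
have [[P' FP] [Q' FQ]] := (corr_total cF Pg, corr_total cF Qg).
have [[P1' FP1] [Q1' FQ1]] := (corr_total cF P1g, corr_total cF Q1g).
have P1w : differ_by w P1' P'.
  apply: (corr_parallel cF Xg P1X (@extend_in P v) v0 FX FY FP1 _ XYw).
  by rewrite P1E.
have [[_ /biinfinite_cl P'cl] [_ /biinfinite_cl P1'cl]] :=
  (corr_biinfinite cF FP, corr_biinfinite cF FP1).
have Q1w : differ_by w Q1' Q'.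
  apply: (corr_parallel cF (biinfinite_perp Pg) _ (@extend_in Q v) v0
    (corr_perpl cF FP) _ FQ1) (differ_by_sym P1'cl P'cl P1w).
  - by apply: extend_sub; [exact: perp_cl|exact: sub_perp_sym|
       move=> p /Pv pv; exact: dotC].
  - by rewrite -perp_extend; exact: corr_perpl.
  - by rewrite Q1E.
have [[_ /biinfinite_cl Q'cl] [_ /biinfinite_cl Q1'cl]] :=
  (corr_biinfinite cF FQ, corr_biinfinite cF FQ1).
apply: (differ_by_side Q1'cl Q'cl (biinfinite_cl Z'g) Q1w).
  by apply/(corr_commutes cF FQ1 FZ); exact: commutes_sub.
by apply/(corr_commutes cF FQ FZ); apply: commutes_sub => q /QZ[].
Qed.

Lemma corr_eq_perp F X X' Y : correspondence F -> ortho_closed Y ->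
  eq_perp X Y -> F X X' ->
  F Y X'.
Proof.
move=> cF Ycl [->|->] // /(corr_perpl cF); by rewrite Ycl.
Qed.

Lemma differ_by_transport F v X X' Y Y' Z Z' w : correspondence F ->
  F X X' -> F Y Y' -> differ_by v X Y -> differ_by w X' Y' -> F Z Z' ->
  side v Z -> side w Z'.
Proof.
move=> cF FX FY [v0 [X1 [Y1 [XX1 YY1 X1cl X1v Y1E]]]] X'Y'w FZ.
have Y1cl : ortho_closed Y1 by rewrite Y1E; apply: clI => //; exact: vperp_cl.
have FX1 := corr_eq_perp cF X1cl XX1 FX.
have FY1 := corr_eq_perp cF Y1cl YY1 FY; rewrite Y1E in FY1.
have [X1g _] := corr_biinfinite cF FX1.
have th := differ_by_transport_hyperplane cF X1g X1v v0 FX1 FY1 X'Y'w.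
by case=> [|vZ]; [exact: th|apply: (th _ _ (corr_perpl cF FZ))].
Qed.

(** * The induced maps on lines and on subspaces *)

(** Vectors stand for the lines that they span. *)
Definition line_corr F v w := exists X X' Y Y',
  [/\ F X X', F Y Y', differ_by v X Y & differ_by w X' Y'].

Lemma line_corr_converse F v w : line_corr F v w -> line_corr (converse F) w v.
Proof. by move=> [X [X' [Y [Y' []]]]] *; exists X', X, Y', Y. Qed.

Lemma line_corr_neq0 F v w : line_corr F v w -> v != 0 /\ w != 0.
Proof. by move=> [X [X' [Y [Y' [_ _ [? _] [? _]]]]]]. Qed.

Lemma line_corr_side F v w Z Z' : correspondence F -> line_corr F v w ->
  F Z Z' -> side v Z <-> side w Z'.
Proof.
move=> cF [X [X' [Y [Y' [FX FY XY X'Y']]]]] FZ; split.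
  exact: (differ_by_transport cF FX FY XY X'Y' FZ).
exact: (differ_by_transport (converse_correspondence cF) FX FY X'Y' XY FZ).
Qed.

Section Infinite.
Hypothesis Vl : large setT.

(** Start from one of two orthogonal infinite-dimensional subspaces P and Q,
    make it orthogonal to s and t, and add s. *)
Lemma biinfinite_separation s t :
  (forall x y, x \in s -> y \in t -> dot x y = 0) ->
  exists X, [/\ biinfinite X, forall x, x \in s -> X x &
    forall y, y \in t -> perp X y].
Proof.
move=> st.
have clT := cl_setT.
have [P [Q [[Pcl Pl _] [Qcl Ql _] PQ]]] := orthogonal_large_pair clT clT Vl Vl.
pose S := perp [set` s]; pose P0 := P `&` perp [set` s ++ t].
have large_seq A (r : seq V) : large A -> large (A `&` perp [set` r]).
  move=> Al r'; have [x [Ax x0 xr]] := Al (r ++ r').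
  exists x; split=> //; last by move=> y yr; apply: xr; rewrite mem_cat yr orbT.
  by split=> // y /= yr; apply: xr; rewrite mem_cat yr.
pose X := perp (perp P0 `&` S).
have pXE : perp X = perp P0 `&` S by apply: clI; exact: perp_cl.
exists X; split.
- split; first exact: perp_cl.
    apply: (largeS _ (large_seq P (s ++ t) Pl)).
    by apply: sub_perp_sym => ? [].
  rewrite pXE; apply: (largeS _ (large_seq Q s Ql)) => q [Qq qs]; split=> //.
  by move=> p [Pp _]; apply: dotC; exact: (PQ p Pp).
- by move=> x xs y [_ ys]; apply: dotC; apply: ys.
- move=> y yt; rewrite pXE; split.
    by move=> p [_ pst]; apply: dotC; apply: pst; rewrite /= mem_cat yt orbT.
  by move=> x xs; apply: dotC; apply: st.
Qed.

(** If u and w are not orthogonal, w1 is the component of w along u.  If they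
    are, w is cut along the sum of w and a third orthogonal vector e. *)
Lemma separating_decomposition u w : u != 0 -> (forall c, w <> c *: u) ->
  exists s w1 w2, [/\ w = w1 + w2, w1 != 0, w2 != 0,
    forall x, x \in s -> dot x w2 = 0 & u \in s /\ w1 \in s].
Proof.
move=> u0 wu.
have wu0 c : w - c *: u != 0 by rewrite subr_eq0; apply/eqP.
pose c := dot w u / dot u u.
have w2u : dot (w - c *: u) u = 0 by rewrite dotBl dotZl divfK ?subrr // dot_neq0.
have [c0|c0] := eqVneq c 0; last first.
  exists [:: u; c *: u], (c *: u), (w - c *: u); split.
  - by rewrite addrC subrK.
  - by rewrite scaler_eq0 negb_or c0.
  - exact: wu0.
  - move=> x; rewrite !inE => /orP[]/eqP->; apply: dotC => //.
    exact: dotZr.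
  - by rewrite !inE !eqxx orbT.
have {}w2u : dot w u = 0 by move: w2u; rewrite c0 scale0r subr0.
have w0 : w != 0 by have := wu0 0; rewrite scale0r subr0.
have [e [_ e0 ee]] := Vl [:: u; w].
have eu : dot e u = 0 by apply: ee; exact: mem_head.
have ew : dot e w = 0 by apply: ee; rewrite !inE eqxx orbT.
pose a := w + e; have aw : dot a w != 0 by rewrite dotDl ew addr0 dot_neq0.
have a0 : a != 0 by apply: contraNneq aw => ->; rewrite dot0l.
have wa : dot w a != 0 by apply: contraNneq aw => /dotC ->.
pose m := dot w a / dot a a.
have m0 : m != 0 by rewrite mulf_neq0 // invr_neq0 // dot_neq0.
exists [:: u; m *: a], (m *: a), (w - m *: a); split.
- by rewrite addrC subrK.
- by rewrite scaler_eq0 negb_or m0.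
- have : dot (w - m *: a) e != 0.
    rewrite dotBl (dotC ew) sub0r oppr_eq0 dotZl mulf_neq0 //.
    by rewrite dotDl (dotC ew) add0r dot_neq0.
  by apply: contraNneq => ->; rewrite dot0l.
- move=> x; rewrite !inE => /orP[]/eqP->; apply: dotC.
    by rewrite dotBl dotZl dotDl w2u eu addr0 mulr0 subr0.
  by apply: dotZr; rewrite dotBl dotZl divfK ?subrr // dot_neq0.
- by rewrite !inE !eqxx orbT.
Qed.

(** A biinfinite subspace containing u and w1 and orthogonal to w2 does not
    commute with the line of w1 + w2. *)
Lemma line_separation u w : u != 0 ->
  (forall X, biinfinite X -> side u X -> side w X) -> exists c, w = c *: u.
Proof.
move=> u0 uw; apply: contrapT => /forallNP wu.
have [s [w1 [w2 [wE w10 w20 sw2 [us w1s]]]]] := separating_decomposition u0 wu.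
have [|X [Xg Xs Xt]] := @biinfinite_separation s [:: w2].
  by move=> x y xs; rewrite inE => /eqP ->; exact: sw2.
have Xcl := biinfinite_cl Xg; have Xw1 := Xs _ w1s.
have Xw2 : perp X w2 by apply: Xt; exact: mem_head.
case: (uw X Xg (or_introl (Xs _ us))) => Xw.
  case/eqP: w20; apply: perp_disj Xw2.
  by rewrite -[w2](addKr w1) -wE addrC; exact: clB.
case/eqP: w10; apply: (perp_disj Xw1).
by rewrite -[w1](addrK w2) -wE; exact: perpB.
Qed.

Lemma line_corr_total F v : correspondence F -> v != 0 ->
  exists w, line_corr F v w.
Proof.
move=> cF v0; have [|X [Xg Xv _]] := @biinfinite_separation [:: v] [::] => //.
have {}Xv : X v by apply: Xv; exact: mem_head.
have [X' FX] := corr_total cF Xg.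
have [Y' FY] := corr_total cF (biinfinite_vperp v Xg).
have XY : differ_by v X (X `&` vperp v).
  by apply: hyperplane_differ_by => //; exact: biinfinite_cl.
have [w X'Y'] := differ_by_corr cF FX FY XY.
by exists w, X, X', (X `&` vperp v), Y'.
Qed.

Lemma line_corr_unique F v w u : correspondence F -> line_corr F v w ->
  line_corr F v u -> exists c, w = c *: u.
Proof.
move=> cF vw vu; apply: line_separation; first by case: (line_corr_neq0 vu).
move=> X' X'g; have [X FX] := corr_onto cF X'g.
by move=> /(line_corr_side cF vu FX)/(line_corr_side cF vw FX).
Qed.

(** Take X containing v and v1.  Both X and X ∩ v⊥ commute with the line of v1,
    so their images commute with that of w1; hence the line of w, their
    difference, is equal or orthogonal to the line of w1.  Equality is excluded
    by [line_separation] since v and v1 span different lines. *)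
Lemma line_corr_dot F v w v1 w1 : correspondence F -> line_corr F v w ->
  line_corr F v1 w1 -> dot v v1 = 0 -> dot w w1 = 0.
Proof.
move=> cF vw v1w1 vv1.
have [v0 w0] := line_corr_neq0 vw; have [v10 w10] := line_corr_neq0 v1w1.
have [|X [Xg Xs _]] := @biinfinite_separation [:: v; v1] [::] => //.
have Xv : X v by apply: Xs; exact: mem_head.
have Xv1 : X v1 by apply: Xs; rewrite !inE eqxx orbT.
have Xcl := biinfinite_cl Xg; have XYg := biinfinite_vperp v Xg.
have [X' FX] := corr_total cF Xg; have [Y' FY] := corr_total cF XYg.
have XY := hyperplane_differ_by Xcl Xv v0.
have [u X'Y'] := differ_by_corr cF FX FY XY.
have vu : line_corr F v u by exists X, X', (X `&` vperp v), Y'.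
have [c ->] := line_corr_unique cF vw vu.
rewrite dotZl.
have w1X' : side w1 X' by apply/(line_corr_side cF v1w1 FX); left.
have w1Y' : side w1 Y'.
  by apply/(line_corr_side cF v1w1 FY); left; split=> //; exact: dotC.
have [u0 [X1 [Y1 [X1X Y1Y X1cl X1u Y1E]]]] := X'Y'.
have side_eq_perp A B : ortho_closed B -> eq_perp A B -> side w1 A -> side w1 B.
  by move=> Bcl [->|->] //; exact: side_perp.
have Y1cl : ortho_closed Y1 by rewrite Y1E; apply: clI => //; exact: vperp_cl.
have {}w1X' := side_eq_perp _ _ X1cl X1X w1X'.
have {}w1Y' := side_eq_perp _ _ Y1cl Y1Y w1Y'.
suff -> : dot u w1 = 0 by rewrite mulr0.
case: w1X' => [X1w1|X1w1]; last by apply: dotC; apply: X1w1.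
move: w1Y'; rewrite Y1E => -[[_ ?]|Y1w1]; first exact: dotC.
have [d w1E] := line_in X1cl X1u u0 X1w1 Y1w1.
have d0 : d != 0 by apply: contra_neq w10 => d0; rewrite w1E d0 scale0r.
have [k vE] : exists k, v1 = k *: v.
  apply: line_separation => // Z Zg vZ; have [Z' FZ] := corr_total cF Zg.
  apply/(line_corr_side cF v1w1 FZ).
  have := vZ; rewrite (line_corr_side cF vu FZ) w1E => -[Z'u|Z'u].
    by left; apply: clZ => //; case: (corr_biinfinite cF FZ) => _ /biinfinite_cl.
  by right; exact: perpZ.
case/eqP: v10; rewrite vE; have [->|k0] := eqVneq k 0; first by rewrite scale0r.
move: vv1 => /dotC; rewrite vE dotZl => /eqP.
by rewrite mulf_eq0 (negPf k0) (negPf (dot_neq0 v0)).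
Qed.

Definition image_subspace F X : set V :=
  [set w | w = 0 \/ exists2 v, X v & line_corr F v w].

Lemma image_subspace_perp F X : correspondence F ->
  image_subspace F (perp X) = perp (image_subspace F X).
Proof.
move=> cF; have cF' := converse_correspondence cF.
apply/seteqP; split=> [w [->|[v Xv vw]] w1 [->|[v1 Xv1 vw1]]|w wX].
- exact: dot0r.
- exact: dot0l.
- exact: dot0r.
- by apply: (line_corr_dot cF vw vw1); exact: Xv.
have [->|w0] := eqVneq w 0; [by left|right].
have [v /line_corr_converse vw] := line_corr_total cF' w0.
exists v => // x Xx; have [->|x0] := eqVneq x 0; first exact: dot0r.
have [y xy] := line_corr_total cF x0.
apply: (line_corr_dot cF' (line_corr_converse vw) (line_corr_converse xy)).
by apply: wX; right; exists x.
Qed.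

Lemma image_subspace_cl F X : correspondence F -> ortho_closed X ->
  ortho_closed (image_subspace F X).
Proof. by move=> cF Xcl; rewrite /ortho_closed -!image_subspace_perp // Xcl. Qed.

Lemma image_subspaceS F X Y : X `<=` Y ->
  image_subspace F X `<=` image_subspace F Y.
Proof.
by move=> XY w [->|[v Xv vw]]; [left|right; exists v => //; exact: XY].
Qed.

Lemma image_subspaceK F X : correspondence F -> ortho_closed X ->
  image_subspace (converse F) (image_subspace F X) = X.
Proof.
move=> cF Xcl; have cF' := converse_correspondence cF.
apply/seteqP; split=> [v [->|[w Fw wv]]|v Xv]; first exact: cl0.
  case: Fw wv => [->|[v1 Xv1 v1w] wv].
    by move=> /line_corr_neq0[]; rewrite eqxx.
  have [c ->] := line_corr_unique cF' wv (line_corr_converse v1w).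
  exact: clZ.
have [->|v0] := eqVneq v 0; [by left|right].
have [w vw] := line_corr_total cF v0.
by exists w; [right; exists v|exact: line_corr_converse].
Qed.

(** Images of non-orthogonal vectors of X are not orthogonal, hence on the same
    side of X'.  Orthogonal v and v2 are connected through v + v2. *)
Lemma image_subspace_sub F X X' v w : correspondence F -> F X X' ->
  X v -> line_corr F v w -> X' w -> image_subspace F X `<=` X'.
Proof.
move=> cF FX Xv vw X'w; have [Xg X'g] := corr_biinfinite cF FX.
have cF' := converse_correspondence cF.
have [Xcl X'cl] := (biinfinite_cl Xg, biinfinite_cl X'g).
have connect v1 w1 v2 w2 : X v1 -> X v2 -> line_corr F v1 w1 -> line_corr F v2 w2 ->
    X' w1 -> dot v1 v2 != 0 -> X' w2.
  move=> Xv1 Xv2 vw1 vw2 X'w1 v12.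
  have /(line_corr_side cF vw2 FX)[//|X'w2] : side v2 X by left.
  case/eqP: v12; apply: (line_corr_dot cF' (line_corr_converse vw1)
    (line_corr_converse vw2)).
  by apply: dotC; exact: X'w2.
move=> w2 [->|[v2 Xv2 vw2]]; first exact: cl0.
have [v0 _] := line_corr_neq0 vw; have [v20 _] := line_corr_neq0 vw2.
have [vv2|vv2] := eqVneq (dot v v2) 0; last exact: (connect v w v2).
pose v3 := v + v2.
have v3v : dot v3 v != 0 by rewrite dotDl (dotC vv2) addr0 dot_neq0.
have v3v2 : dot v3 v2 != 0 by rewrite dotDl vv2 add0r dot_neq0.
have v30 : v3 != 0 by apply: contraNneq v3v => ->; rewrite dot0l.
have [w3 vw3] := line_corr_total cF v30.
have Xv3 : X v3 by exact: clD.
apply: (connect v3 w3 v2) => //; apply: (connect v w v3) => //.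
by apply: contraNneq v3v => /dotC ->.
Qed.

Lemma image_subspace_eq_perp F X X' : correspondence F -> F X X' ->
  X' = image_subspace F X \/ X' = perp (image_subspace F X).
Proof.
move=> cF FX; have [Xg X'g] := corr_biinfinite cF FX.
have [Xcl X'cl] := (biinfinite_cl Xg, biinfinite_cl X'g).
have half X1 : F X1 X' -> image_subspace F X1 `<=` X' \/
    image_subspace F X1 `<=` perp X'.
  move=> FX1; have [[_ /large_neq0[v X1v v0] _] _] := corr_biinfinite cF FX1.
  have [w vw] := line_corr_total cF v0.
  have /(line_corr_side cF vw FX1)[X'w|X'w] : side v X1 by left.
    by left; exact: (image_subspace_sub cF FX1 X1v vw).
  by right; exact: (image_subspace_sub cF (corr_perpr cF FX1) X1v vw).
set I := image_subspace F X in half *.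
have Icl : ortho_closed I by exact: image_subspace_cl.
have := half _ (corr_perpl cF FX); rewrite image_subspace_perp // -/I.
have full Z : biinfinite Z -> I `<=` Z -> perp I `<=` Z -> False.
  move=> Zg IZ pIZ; apply: (biinfinite_proper Zg) => v.
  have [a Ia Iva] := cl_split v Icl; rewrite -[v](subrK a).
  by apply: clD; [exact: biinfinite_cl|exact: pIZ|exact: IZ].
case: (half _ FX) => IX' [pIX'|pIX'].
- by case: (full _ X'g IX').
- by left; apply/seteqP; split=> //; exact: cl_sub.
- right; apply/seteqP; split=> //; exact: sub_perp_sym.
- by case: (full _ (biinfinite_perp X'g) IX').
Qed.

End Infinite.

End Orthomodular.

(** * Hilbert spaces *)

Section Hilbert.
Variables (R : realType) (H : completeNormedModType R[i]).
Variable dot : {dot H for @Num.conj R[i]}.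
Hypothesis dot_norm : forall x : H, `|x| ^+ 2 = dot x x.
Implicit Types (X Y C : set H) (u v w x y : H).

Lemma ltr0c (e : R) : (0 < e%:C) = (0 < e).
Proof. exact: ltcR 0 e. Qed.

Definition sqnorm x : R := complex.Re (dot x x).

Lemma sqnormE x : dot x x = (sqnorm x)%:C.
Proof. by rewrite RRe_real // ger0_real // dnorm_ge0. Qed.

Lemma sqnorm_ge0 x : 0 <= sqnorm x.
Proof. by rewrite -ler0c -sqnormE dnorm_ge0. Qed.

Lemma sqnorm0 : sqnorm 0 = 0.
Proof. by rewrite /sqnorm linear0r. Qed.

Lemma sqnorm_eq0 x : sqnorm x = 0 -> x = 0.
Proof. by move=> x0; apply/eqP; rewrite -(dnorm_eq0 dot) sqnormE x0. Qed.

Lemma norm_lt x (e : R) : 0 < e -> (`|x| < e%:C) = (sqnorm x < e ^+ 2).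
Proof.
move=> e0; rewrite -(@ltr_pXn2r _ 2) ?nnegrE ?ler0c ?(ltW e0) //.
by rewrite dot_norm sqnormE -rmorphXn /= ltcR.
Qed.

Lemma parallelogram x y :
  sqnorm (x + y) + sqnorm (x - y) = 2 * sqnorm x + 2 * sqnorm y.
Proof.
apply: complexI; rewrite !mulr_natl !mulr2n !rmorphD /= -!sqnormE.
rewrite dnormD dnormB /=; ring.
Qed.

Lemma sqnormD_le x y : sqnorm (x + y) <= 2 * sqnorm x + 2 * sqnorm y.
Proof. by rewrite -parallelogram lerDl sqnorm_ge0. Qed.

Lemma pythagoras x y : dot x y = 0 -> sqnorm (x + y) = sqnorm x + sqnorm y.
Proof.
move=> xy; apply: complexI; rewrite rmorphD /= -!sqnormE dnormD /= xy.
by rewrite conjC0 !addr0.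
Qed.

(** The orthogonal projection onto the line of x; it replaces the
    Cauchy-Schwarz inequality in the limit arguments. *)
Definition lineproj x u : H := (dot u x / dot x x) *: x.

Lemma lineprojD x u v : lineproj x (u + v) = lineproj x u + lineproj x v.
Proof. by rewrite /lineproj linearDl mulrDl scalerDl. Qed.

Lemma lineprojB x u v : lineproj x (u - v) = lineproj x u - lineproj x v.
Proof. by rewrite /lineproj linearBl mulrBl scalerBl. Qed.

Lemma lineproj0 x u : dot u x = 0 -> lineproj x u = 0.
Proof. by move=> ux; rewrite /lineproj ux mul0r scale0r. Qed.

Lemma sqnorm_lineproj x u :
  sqnorm u = sqnorm (u - lineproj x u) + sqnorm (lineproj x u).
Proof.
rewrite -pythagoras ?subrK // /lineproj linearZr_LR /= linearBl linearZl_LR /=.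
have [->|x0] := eqVneq x 0; first by rewrite !linear0r !mul0r subr0 mulr0.
by rewrite divfK ?subrr ?mulr0 // dnorm_eq0.
Qed.

Lemma lineproj_le x u : sqnorm (lineproj x u) <= sqnorm u.
Proof. by rewrite [leRHS](sqnorm_lineproj x) lerDr sqnorm_ge0. Qed.

Lemma lineproj_eq0 x u : lineproj x u = 0 -> dot u x = 0.
Proof.
have [->|x0] := eqVneq x 0; first by rewrite linear0r.
move=> /eqP; rewrite scaler_eq0 (negPf x0) orbF mulf_eq0 invr_eq0 dnorm_eq0.
by rewrite (negPf x0) orbF => /eqP.
Qed.

Lemma closure_approx C x (e : R) : 0 < e -> closure C x ->
  exists2 c, C c & sqnorm (x - c) < e ^+ 2.
Proof.
move=> e0 /(_ (ball x e%:C))[|c [Cc]].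
  by apply: nbhsx_ballx; rewrite ltr0c.
by rewrite -ball_normE /ball_ /= norm_lt //; exists c.
Qed.

Lemma le_small (a : R) : (forall e : R, 0 < e -> a <= e) -> a <= 0.
Proof.
by move=> ae; rewrite leNgt; apply/negP => a0; have := ae (a / 2); lra.
Qed.

(** The projection of y onto the line of x is that of y - c for every c
    orthogonal to x, hence as small as the distance from y to x⊥. *)
Lemma perp_closed C : closed (perp dot C).
Proof.
move=> y yC x Cx; apply: lineproj_eq0; apply: sqnorm_eq0; apply/eqP.
rewrite eq_le sqnorm_ge0 andbT; apply: le_small => e e0.
have [c Cc yc] : exists2 c, perp dot C c & sqnorm (y - c) < Num.sqrt e ^+ 2.
  by apply: closure_approx yC; rewrite sqrtr_gt0.
rewrite sqr_sqrtr ?(ltW e0) // in yc; apply: le_trans (ltW yc).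
apply: le_trans (lineproj_le x _).
by rewrite lineprojB (lineproj0 (Cc x Cx)) subr0.
Qed.

Lemma submodP C : submod_closed [in C] ->
  C 0 /\ forall a u v, C u -> C v -> C (a *: u + v).
Proof.
move=> [C0 Clin]; split; first by rewrite inE in C0.
by move=> a u v Cu Cv; have := Clin a u v; rewrite !inE; exact.
Qed.

(** A minimizing sequence c n for the distance from v to C is a Cauchy sequence
    by the parallelogram identity.  Instead of showing that its limit a attains
    the distance, one observes that v - c n is nearly orthogonal to every x in
    C: the projection of v - c n onto the line of x has square norm at most the
    defect of minimality of c n. *)
Lemma projection_theorem C v : closed_subspaces C ->
  exists2 a, C a & perp dot C (v - a).
Proof.
move=> [/submodP[C0 Clin] Cclosed].
pose D := [set sqnorm (v - c) | c in C]; pose d := inf D.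
have D_inf : has_inf D.
  split; first by exists (sqnorm (v - 0)); exists 0.
  by exists 0 => _ [c _ <-]; exact: sqnorm_ge0.
have dD c : C c -> d <= sqnorm (v - c).
  by move=> Cc; apply: ge_inf; [case: D_inf|exists c].
have /choice[c cP] : forall n : nat, exists c,
    C c /\ sqnorm (v - c) < d + n.+1%:R^-1.
  move=> n; have n0 : 0 < n.+1%:R^-1 :> R by rewrite invr_gt0 ltr0n.
  by have [_ [c Cc <-] cd] := inf_adherent n0 D_inf; exists c.
have Cc n : C (c n) by case: (cP n).
have c_dist m n : (m <= n)%N -> sqnorm (c m - c n) <= 4 * m.+1%:R^-1.
  move=> mn.
  have nm : n.+1%:R^-1 <= m.+1%:R^-1 :> R.
    by rewrite lef_pV2 ?posrE ?ltr0n // ler_nat ltnS.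
  have := parallelogram (v - c m) (v - c n).
  have -> : (v - c m) - (v - c n) = - (c m - c n).
    by rewrite [RHS]opprB opprB [LHS]addrC addrA subrK.
  pose h := 2^-1 *: (c m + c n).
  have Ch : C h.
    by rewrite /h scalerDr; apply: (Clin) => //; rewrite -[_ *: _]addr0; exact: Clin.
  have -> : sqnorm (- (c m - c n)) = sqnorm (c m - c n).
    by rewrite /sqnorm linearNl linearNr opprK.
  have -> : (v - c m) + (v - c n) = (v - h) + (v - h).
    rewrite addrACA -opprD [in RHS]addrACA -[in RHS]opprD; congr (_ - _).
    rewrite /h -scalerDl -[X in X + X]mul1r -mulrDl -[1 + 1]/(2%:R).
    by rewrite mulfV ?pnatr_eq0 // scale1r.
  have := parallelogram (v - h) (v - h).
  rewrite subrr sqnorm0 => E1 E2.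
  have [_ cm] := cP m; have [_ cn] := cP n; have := dD h Ch.
  by move: nm cm cn E1 E2; move: n.+1%:R^-1 m.+1%:R^-1 => p q; lra.
have cvg_c : cvg (c @ \oo).
  apply/cauchy_cvgP/cauchy_exP => e e0.
  have eE : e = (complex.Re e)%:C by rewrite RRe_real // gtr0_real.
  have {}e0 : 0 < complex.Re e by rewrite -ltr0c -eE.
  have r0 : 0 < complex.Re e ^+ 2 / 4 by rewrite divr_gt0 ?exprn_gt0.
  have [N _ NP] := near_infty_natSinv_lt (PosNum r0).
  exists (c N); exists N => // n /= Nn.
  rewrite -ball_normE /ball_ /= eE norm_lt //.
  have /= := NP N (leqnn N); have := c_dist N n Nn.
  by move: N.+1%:R^-1 => p; lra.
exists (lim (c @ \oo)).
  by apply: closed_cvg cvg_c => //; near=> n; exact: Cc.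
set a := lim _ => x Cx.
apply: lineproj_eq0; apply: sqnorm_eq0; apply/eqP.
rewrite eq_le sqnorm_ge0 andbT; apply: le_small => e e0.
have [n [cn na]] : exists n : nat, n.+1%:R^-1 < e / 4 /\ sqnorm (c n - a) < e / 4.
  have r0 : 0 < e / 4 by rewrite divr_gt0.
  have [N _ NP] := near_infty_natSinv_lt (PosNum r0).
  have /cvg_ballP/(_ (Num.sqrt (e / 4))%:C) : c @ \oo --> a by [].
  rewrite ltr0c sqrtr_gt0 => /(_ r0)[M _ MP].
  exists (maxn N M); split; first exact: NP (leq_maxl N M).
  have := MP _ (leq_maxr N M); rewrite -ball_normE /ball_ /= norm_lt ?sqrtr_gt0 //.
  by rewrite sqr_sqrtr ?(ltW r0) // -opprB /sqnorm linearNl linearNr opprK.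
have near_orth : sqnorm (lineproj x (v - c n)) <= n.+1%:R^-1.
  have := sqnorm_lineproj x (v - c n); have [_] := cP n.
  move: cn n.+1%:R^-1 => _ p ?.
  suff : d <= sqnorm (v - c n - lineproj x (v - c n)) by lra.
  rewrite -addrA -opprD; apply: dD; rewrite addrC; exact: Clin.
have -> : v - a = (v - c n) + (c n - a) by rewrite addrA subrK.
rewrite lineprojD; apply: le_trans (sqnormD_le _ _) _.
have := lineproj_le x (c n - a); move: cn near_orth.
by move: n.+1%:R^-1 => p; lra.
Unshelve. all: by end_near.
Qed.

Lemma perp_closed_subspace C : closed_subspaces (perp dot C).
Proof.
split; last exact: perp_closed.
split=> [|a u v]; first by rewrite inE => x _; rewrite linear0l.
rewrite !inE => Cu Cv x Cx.
by rewrite linearPl /= (Cu x Cx) (Cv x Cx) mulr0 addr0.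
Qed.

Lemma dot_reflexive u v : dot u v = 0 -> dot v u = 0.
Proof. by move=> uv; rewrite hermC /= uv conjC0 expr0 mulr0. Qed.

Lemma hilbert_orthomodular : orthomodular_form dot.
Proof.
split.
- by move=> a u v w; rewrite linearPl.
- exact: dot_reflexive.
- by move=> u /eqP; rewrite dnorm_eq0 => /eqP.
- by move=> A v; apply: projection_theorem; exact: perp_closed_subspace.
Qed.

Let dotP := hilbert_orthomodular.

Lemma closed_subspacesP X : closed_subspaces X <-> ortho_closed dot X.
Proof.
split=> [Xc|<-]; last exact: perp_closed_subspace.
apply/seteqP; split; last exact: (sub_perpK dotP).
move=> v Xv; have [a Xa Xva] := projection_theorem v Xc.
suff /eqP : v - a = 0 by rewrite subr_eq0 => /eqP ->.
apply: (perp_disj dotP Xva); apply: (perpB dotP Xv).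
exact: (sub_perpK dotP).
Qed.

(** If finitely many vectors span H modulo X, no nonzero vector of X⊥ is
    orthogonal to all of them; conversely a basis of X⊥ spans H modulo X. *)
Lemma not_finite_codim_large X : ortho_closed dot X -> ~ finite_codim X <->
  large dot (perp dot X).
Proof.
move=> Xcl; split=> [Xinf|Xl [s sX]].
  apply: contrapT => /(not_large_finite dotP (perp_cl dotP X))[s Xs].
  apply: Xinf; exists s => v; have [a Xa Xva] := cl_split dotP v Xcl.
  by exists a => //; rewrite -Xs.
have [x [Xx /eqP x0 xs]] := Xl s; apply: x0.
have [a Xa sxa] := sX x; apply: (form_anisotropic dotP).
rewrite -{2}[x](subrK a); apply: (dotDr dotP); last exact: Xx.
exact: (lspan_perp dotP xs).
Qed.

Lemma GinftyP X : Ginfty X <-> biinfinite dot X.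
Proof.
split=> [[Xc Xfin Xcofin]|[Xcl Xl pXl]].
  have Xcl : ortho_closed dot X by exact/closed_subspacesP.
  split=> //; last exact/not_finite_codim_large.
  by apply: contrapT => /(not_large_finite dotP Xcl).
split; first exact/closed_subspacesP.
  exact: large_infinite Xl.
exact/not_finite_codim_large.
Qed.

Lemma compatibleP X Y : ortho_closed dot X -> ortho_closed dot Y ->
  compatible dot X Y <-> commutes dot X Y.
Proof.
move=> Xcl Ycl; split=> [[X' [Y' [_ [XX' _ XY'] XE YE]]]|XY].
  move=> x; rewrite {1}XE => -[a [Xa Ya] [b Xb <-]]; exists a => //.
  rewrite addrC addKr => y; rewrite YE => -[c XYc [d Yd <-]].
  rewrite linearDr /= (XY' b d) // addr0.
  by apply: dot_reflexive; exact: XX'.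
exists (X `&` perp dot Y), (Y `&` perp dot X).
have pXcl := perp_cl dotP X; have pYcl := perp_cl dotP Y.
split.
- by split; apply/closed_subspacesP; exact: clI.
- split=> x y.
  + by move=> [_ Yx] [_ Yy]; apply: dot_reflexive; exact: Yy.
  + by move=> [Xx _] [_ Xy]; apply: dot_reflexive; exact: Xy.
  + by move=> [_ Yx] [Yy _]; exact: Yx.
- apply/seteqP; split=> [x Xx|_ [a [Xa _] [b [Xb _] <-]]]; last exact: (clD dotP Xcl).
  have [a XYa Yxa] := XY x Xx; exists a => //; exists (x - a); last first.
    by rewrite addrC subrK.
  by split=> //; apply: (clB dotP Xcl) => //; case: XYa.
- have YX := commutes_sym dotP Xcl Ycl XY.
  apply/seteqP; split=> [y Yy|_ [a [_ Ya] [b [Yb _] <-]]]; last exact: (clD dotP Ycl).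
  have [a YXa Xya] := YX y Yy; exists a; first by case: YXa.
  exists (y - a); last by rewrite addrC subrK.
  by split=> //; apply: (clB dotP Ycl) => //; case: YXa.
Qed.

End Hilbert.

Theorem theorem3p5 (R : realType) (H : completeNormedModType R[i])
    (dot : {dot H for @Num.conj R[i]})
    (dot_norm : forall x : H, `|x| ^+ 2 = dot x x)
    (H_infinite : ~ finite_dim [set: H])
    (f : set H -> set H)
    (f_bij : set_bij (@Ginfty R H) (@Ginfty R H) f)
    (f_compatible : forall X Y : set H, Ginfty X -> Ginfty Y ->
       (compatible dot X Y <-> compatible dot (f X) (f Y))) :
  exists g : set H -> set H, logic_automorphism dot g /\
    forall X : set H, Ginfty X ->
      f X = g X \/ f X = orthocomplement dot (g X).
Proof.
have dotP := hilbert_orthomodular dot_norm.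
have clP := closed_subspacesP dot_norm.
have GP X : Ginfty X <-> biinfinite dot X by exact: GinftyP.
have Hl : large dot setT.
  by apply: contrapT => /(not_large_finite dotP (cl_setT dotP)).
have f_comm X Y : biinfinite dot X -> biinfinite dot Y ->
    commutes dot X Y <-> commutes dot (f X) (f Y).
  move=> /[dup] /GP Xg Xg' /[dup] /GP Yg Yg'.
  have [[Xcl _ _] [Ycl _ _]] := (Xg', Yg').
  have [/GP[fXcl _ _] /GP[fYcl _ _]] : Ginfty (f X) /\ Ginfty (f Y).
    by case: f_bij => fG _ _; split; exact: fG.
  rewrite -(compatibleP dot_norm Xcl Ycl) -(compatibleP dot_norm fXcl fYcl).
  exact: f_compatible.
(* X' is the image of X up to complement: its commutant is the image of the
   commutant of X. *)
pose F X X' := [/\ biinfinite dot X, biinfinite dot X' &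
  forall Z, biinfinite dot Z -> commutes dot Z X <-> commutes dot (f Z) X'].
have fG X : biinfinite dot X -> biinfinite dot (f X).
  by move=> /GP XG; apply/GP; case: f_bij => fG _ _; exact: fG.
have onto X' : biinfinite dot X' -> exists2 X, biinfinite dot X & f X = X'.
  by move=> /GP; case: f_bij => _ _ /[apply] -[X /GP]; exists X.
have Ff X : biinfinite dot X -> F X (f X).
  by move=> Xg; split=> // [|Z Zg]; [exact: fG|exact: f_comm].
have cF : correspondence dot F.
  split.
  - by move=> X X' [].
  - by move=> X Xg; exists (f X); exact: Ff.
  - by move=> X' /onto[X Xg <-]; exists X; exact: Ff.
  - move=> X X' [Xg X'g XX']; split=> // [|Z Zg]; first exact: biinfinite_perp.
    by rewrite (commutes_perprE dotP (biinfinite_cl Zg) (biinfinite_cl Xg)); exact: XX'.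
  - move=> X X' [Xg X'g XX']; split=> // [|Z Zg]; first exact: biinfinite_perp.
    by rewrite (commutes_perprE dotP (biinfinite_cl (fG _ Zg)) (biinfinite_cl X'g)); exact: XX'.
  - move=> X X' Y Y' [Xg X'g XX'] [Yg Y'g YY'].
    have commC A B : biinfinite dot A -> biinfinite dot B ->
        commutes dot A B <-> commutes dot B A.
      by move=> /biinfinite_cl ? /biinfinite_cl ?; split; exact: commutes_sym.
    have [Y0 Y0g Y0E] := onto Y' Y'g.
    rewrite (YY' X Xg) -Y0E -(f_comm _ _ Xg Y0g) (commC X) // (XX' _ Y0g).
    by rewrite commC //; exact: fG.
exists (image_subspace dot F).
have cF' := converse_correspondence cF.
split; first split.
- split.
  + by move=> X /clP Xcl; apply/clP; exact: image_subspace_cl.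
  + move=> X Y; rewrite !inE => /clP Xcl /clP Ycl XY.
    by rewrite -(image_subspaceK dotP Hl cF Xcl) XY image_subspaceK.
  + move=> Y /clP Ycl; exists (image_subspace dot (converse F) Y).
      by apply/clP; exact: image_subspace_cl.
    exact: (image_subspaceK dotP Hl cF').
- move=> X Y /clP Xcl /clP Ycl; split; first exact: image_subspaceS.
  move=> /(@image_subspaceS _ _ dot (converse F)).
  by rewrite !image_subspaceK.
- by move=> X _; exact: image_subspace_perp.
move=> X /GP Xg; have [E|E] := image_subspace_eq_perp dotP Hl cF (Ff X Xg).
  by left.
by right.
Qed.
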